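(* Let $\mu_0,\mu_1,\mu_3\in\mathbb C$ with $\mu_0\ne0$, and for $t\in\mathbb C$ let $\nu_t=\left(-z^{-4}+\mu_3z^{-3}+tz^{-2}+\mu_1z^{-1}+\mu_0\right)dz^2$ (the Hitchin base for $D=2\cdot\{0\}+2\cdot\{\infty\}$, two untwisted poles of order two). Let $g_{\mathrm{sK}}$ be the special Kähler metric on the base, and for $|t|$ large let $\tau(t)$ be the modulus of the Hitchin fibre $H^{-1}(t)$, i.e. of the elliptic curve $(a_0+(-\mu_0)^{1/2}c_0^2)^2=-\tilde\nu_t(-c_0)$, $(a_0,c_0)\in\mathbb C^2$, with $\tilde\nu_t(z)=z^4\nu_t(z)$. Then, as $r=|t|\to\infty$, $$g_{\mathrm{sK}}=(4\pi\log r+O(1))\,r^{-1}g_{\mathrm{Euc}},$$ where $g_{\mathrm{Euc}}=dr^2+r^2d\theta^2$, $t=re^{i\theta}$, and $$\tau(t)=\frac{i}{\pi}\log\big(4(-\mu_0)^{-1/2}t\big)+\frac{i}{\pi}\cdot\frac{\mu_1^2-\mu_0\mu_3^2}{8\mu_0}\,t^{-1}+O(|t|^{-2}).$$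
   Context: $g_{\mathrm{sK}}$ at $t$ is given, for the tangent vector $\dot\nu=\dot t\,z^{-2}dz^2$, by $g_{\mathrm{sK}}(\dot\nu,\dot\nu)=\int_{\mathbb C}\frac{|\dot tz^{-2}|^2}{|\nu_t(z)|}\,i\,dz\,d\bar z$, where $\nu_t=\nu_t(z)dz^2$; it is the metric on the regular part of the Hitchin base induced by the semiflat metric. The roots of $\tilde\nu_t$ are labelled so that $z_k(t)\sim(-1)^{k-1}t^{-1/2}$ for $k=1,2$ and $z_k(t)\sim(-1)^{k-1}(-\mu_0)^{-1/2}t^{1/2}$ for $k=3,4$ (fixed choice of square roots), and $\tau(t)=\lambda^{-1}(l(t))$ with $l=\frac{(z_1-z_2)(z_3-z_4)}{(z_3-z_2)(z_1-z_4)}$, where $\lambda$ is the modular lambda function (so $\lambda(\tau)\sim16e^{i\pi\tau}$ as $\mathrm{Im}\,\tau\to\infty$, and $\mathrm{Im}\,\tau(t)\to\infty$; $\tau$ is determined up to the choice of branch of the logarithm). *)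

(* Defs.v *)
From HB Require Import structures.
From mathcomp Require Import all_boot all_order all_algebra.
From mathcomp Require Import all_classical all_reals all_analysis.
From mathcomp Require Import complex ring.

Set Implicit Arguments.
Unset Strict Implicit.
Unset Printing Implicit Defensive.

Import Order.TTheory GRing.Theory Num.Theory numFieldNormedType.Exports.

Local Open Scope classical_set_scope.
Local Open Scope complex_scope.
Local Open Scope ring_scope.

Section ComplexAnalysis.
Variable R : realType.
Local Notation C := R[i].

(* The real-valued modulus; the norm `|z| of MathComp has values in C. *)
Definition cabs (z : C) : R := Normc.normc z.

(* Neighbourhoods of infinity in C, i.e. the filter for |t| -> oo. *)
Definition cinfty : set_system C :=
  filter_from setT (fun r : R => [set t | r < cabs t]).

Global Instance cinfty_filter : ProperFilter cinfty.
Proof.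
apply: filter_from_proper.
  apply: filter_from_filter; first by exists 0.
  move=> r s _ _; exists (Num.max r s) => // t /=.
  by rewrite gt_max => /andP[].
move=> r _; exists (`|r| + 1)%:C => /=.
rewrite /cabs /= expr0n addr0 sqrtr_sqr.
apply: (le_lt_trans (ler_norm r)).
by rewrite [ltRHS]ger0_norm ?ltrDl ?addr_ge0.
Qed.

(* f(t) ~ g(t) as |t| -> oo *)
Definition cequiv (f g : C -> C) : Prop :=
  cabs (f t / g t - 1) @[t --> cinfty] --> (0 : R).

Definition cexp (z : C) : C :=
  (expR (complex.Re z))%:C * (cos (complex.Im z) +i* sin (complex.Im z)).

(* R[i] carries no topology in the libraries: limits are taken on real and
   imaginary parts. *)
Definition climn (u : nat -> C) : C :=
  limn (fun n => complex.Re (u n)) +i* limn (fun n => complex.Im (u n)).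

(* theta_2 = \sum_(n in Z) e^(i pi (n + 1/2)^2 tau), where the terms of index
   n and - n - 1 coincide. *)
Definition theta2 (tau : C) : C :=
  2 * climn (fun N => \sum_(0 <= n < N)
    cexp ('i%C * pi%:C * (n%:R + 2^-1) ^+ 2 * tau)).

(* theta_3 = \sum_(n in Z) e^(i pi n^2 tau), where the terms of index n and
   - n coincide. *)
Definition theta3 (tau : C) : C :=
  1 + 2 * climn (fun N => \sum_(1 <= n < N)
    cexp ('i%C * pi%:C * n%:R ^+ 2 * tau)).

(* The modular lambda function on the upper half plane, normalized by
   lambda(tau) ~ 16 e^(i pi tau) as Im tau -> oo. *)
Definition modular_lambda (tau : C) : C := theta2 tau ^+ 4 / theta3 tau ^+ 4.

Definition cross_ratio (z1 z2 z3 z4 : C) : C :=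
  ((z1 - z2) * (z3 - z4)) / ((z3 - z2) * (z1 - z4)).

Definition branch_point (E : set (C * C)) (c : C) : Prop :=
  exists! a : C, E (a, c).

(* tau is a modulus of (the completion of) the double cover E -> C,
   (a, c) |-> c, for the ordering b1, b2, b3, b4 of its branch points. *)
Definition is_modulus (E : set (C * C)) (b1 b2 b3 b4 tau : C) : Prop :=
  [/\ uniq [:: b1; b2; b3; b4],
      forall c, branch_point E c <-> c \in [:: b1; b2; b3; b4],
      0 < complex.Im tau
    & modular_lambda tau = cross_ratio b1 b2 b3 b4].

End ComplexAnalysis.

Arguments cinfty : clear implicits.

Section HitchinBase.
Variable R : realType.
Local Notation C := R[i].
Variables mu0 mu1 mu3 : C.

(* The coefficient nu_t(z) of dz^2; the junk value at z = 0 is irrelevant to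
   integrals. *)
Definition nu (t z : C) : C :=
  - z ^- 4 + mu3 * z ^- 3 + t * z ^- 2 + mu1 * z^-1 + mu0.

Definition nut (t : C) : {poly C} :=
  - 1 + mu3 *: 'X + t *: 'X^2 + mu1 *: 'X^3 + mu0 *: 'X^4.

Lemma nutE (t z : C) : z != 0 -> (nut t).[z] = z ^+ 4 * nu t z.
Proof. by move=> z0; rewrite /nut /nu !hornerE /=; field. Qed.

(* The quadratic form g_sK at t on the tangent vector td * z^-2 dz^2.  The
   factor 2 comes from i dz d\bar z = 2 dx dy, where z = x + i y. *)
Definition g_sK (t td : C) : \bar R :=
  (\int[lebesgue_measure \x lebesgue_measure]_(p in [set: R * R])
     let z : C := p.1 +i* p.2 in
     (2 * (cabs (td * z ^- 2) ^+ 2 / cabs (nu t z)))%:E)%E.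

(* The quadratic form dr^2 + r^2 dtheta^2 = dx^2 + dy^2. *)
Definition g_Euc (td : C) : R := complex.Re td ^+ 2 + complex.Im td ^+ 2.

(* The Hitchin fibre over t, as a set of pairs (a0, c0); s is the chosen
   square root of - mu0. *)
Definition hitchin_fibre (s t : C) : set (C * C) :=
  [set p | (p.1 + s * p.2 ^+ 2) ^+ 2 = - (nut t).[- p.2]].

Lemma hitchin_fibre_branch_point (s t z : C) :
  branch_point (hitchin_fibre s t) (- z) <-> root (nut t) z.
Proof.
rewrite /branch_point /hitchin_fibre /= opprK; split.
  move=> [a [/= Ha U]].
  have /U Hb : (- a - 2 * s * (- z) ^+ 2 + s * (- z) ^+ 2) ^+ 2 = - (nut t).[z].
    by rewrite -Ha; ring.
  have H : a + s * (- z) ^+ 2 = 0.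
    have : 2 * (a + s * (- z) ^+ 2) = 0.
      by rewrite {1}mulrDr mulrDl mul1r {1}Hb; ring.
    by move/eqP; rewrite mulf_eq0 pnatr_eq0 /= => /eqP.
  by rewrite /root -oppr_eq0 -Ha H expr0n.
move=> /eqP ->; exists (- (s * (- z) ^+ 2)); split => /=.
  by rewrite addNr expr0n /= oppr0.
move=> b; rewrite oppr0 => /eqP; rewrite expf_eq0 /= => /eqP H.
by apply/eqP; rewrite eq_sym -addr_eq0 H.
Qed.

(* Labelling of the roots for |t| large; s is the chosen square root of - mu0
   and sq t that of t. *)
Definition labelled_roots (s : C) (sq z1 z2 z3 z4 : C -> C) : Prop :=
  [/\ \forall t \near cinfty R, nut t =
        mu0 *: (('X - (z1 t)%:P) * ('X - (z2 t)%:P)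
                * ('X - (z3 t)%:P) * ('X - (z4 t)%:P)),
      cequiv z1 (fun t => (sq t)^-1),
      cequiv z2 (fun t => - (sq t)^-1),
      cequiv z3 (fun t => s^-1 * sq t)
    & cequiv z4 (fun t => - (s^-1 * sq t))].

(* tau(t) = lambda^-1(l(t)), for the branch of lambda^-1 near the cusp.  The
   branch points of the fibre are the opposites of the roots of nut t, and
   the cross-ratio l is invariant under z |-> - z. *)
Definition fibre_modulus (s : C) (z1 z2 z3 z4 tau : C -> C) : Prop :=
  (\forall t \near cinfty R, is_modulus (hitchin_fibre s t)
      (- z1 t) (- z2 t) (- z3 t) (- z4 t) (tau t)) /\
  complex.Im (tau t) @[t --> cinfty R] --> +oo.

End HitchinBase.

(* Main.v *)
Require Import Defs.
From HB Require Import structures.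
From mathcomp Require Import all_boot all_order all_algebra.
From mathcomp Require Import all_classical all_reals all_analysis.
From mathcomp Require Import complex.
From mathcomp Require Import measurable_realfun interval_inference.
From mathcomp Require Import ring lra zify.
Import Order.TTheory GRing.Theory Num.Theory numFieldNormedType.Exports.
Local Open Scope classical_set_scope.
Local Open Scope complex_scope.
Local Open Scope ring_scope.

(** Both parts rest on the sizes of the roots of [nut t].  The sum of the six
    products of two roots is [t / mu0], so some pair [c, d] has a product of
    size at least a multiple of |t|.  Vieta's relations, rescaled by powers of
    t, then determine the discriminants [(a - b)^2] and [(c - d)^2] of this
    pair and of the complementary one up to a relative error O(t^-2).

    For the metric, [g_sK] is [2 |td|^2] times the integral of [1 / |nut t|].
    On the annulus M |t|^(-1/2) <= |z| <= |t|^(1/2) / M the term [t z^2]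
    dominates and 1 / (|t| |z|^2) integrates to
    (2 pi / |t|) (log |t| - 2 log M).  The error there, and the integrand near
    either pair of roots and near infinity, are bounded by multiples of
    1 / |z - p| on discs and of 1 / |z - p|^3 off discs, whose integrals are of
    order 1 / |t|.

    For the modulus, put q = exp (i pi tau).  Then lambda = 16 q (1 - 8 q + O(q^2)),
    hence 1 / q = 16 / l - 8 + O(q).  With N = (a - b)(c - d), the
    denominator of l is N / 2 - (ab + cd - (a + b)(c + d) / 2), so that the
    constant 8 cancels and 1 / q is, up to a relative error O(t^-2),
    a multiple of t / N.  The product of the two discriminants gives N, and
    taking logarithms gives tau. *)

Set Implicit Arguments.
Unset Strict Implicit.
Unset Printing Implicit Defensive.

(** * Integrals over the plane *)

Section PlaneIntegrals.
Context {R : realType}.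
Local Notation mu := (@lebesgue_measure R).

(** Lebesgue measure is characterised by its values on half-open intervals, and the preimage of []a,
    b]] has length (b - a) / k. *)
Lemma pushforward_affine_lebesgue (k c : R) (k0 : 0 < k) (A : set R) :
  measurable A ->
  (k%:E * pushforward mu
    (fun x : measurableTypeR R => (k * x + c)%R : measurableTypeR R) A = mu A)%E.
Proof.
have mk : @measurable_fun _ _ (measurableTypeR R) (measurableTypeR R) setT
     (fun x : R => k * x + c).
  by apply: measurable_funD => //; exact: mulrl_measurable.
pose phi : {mfun measurableTypeR R >-> measurableTypeR R} :=
   HB.pack (fun x : measurableTypeR R => k * x + c : measurableTypeR R)
   (isMeasurableFun.Build _ _ _ _ _ mk).
pose kk := NngNum (ltW k0).
move=> mA; apply/esym.
apply: (@lebesgue_measure_unique R (mscale kk (pushforward mu phi))) => //=.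
move=> _ [[a b]] _ <-.
rewrite /mscale/= /pushforward /=.
have -> : (fun x : R => k * x + c) @^-1` `]a, b]%classic =
    `](a - c) / k, (b - c) / k]%classic.
  apply/seteqP; split => x /=; rewrite !in_itv /= ltr_pdivrMr // ler_pdivlMr // mulrC.
    by move=> /andP[h1 h2]; apply/andP; split; lra.
  by move=> /andP[h1 h2]; apply/andP; split; lra.
rewrite !lebesgue_measure_itv/= !lte_fin ltr_pM2r ?invr_gt0 // ltrD2r.
case: ifPn => _; last by rewrite mule0.
rewrite -!EFinD -EFinM; congr EFin.
by field; rewrite gt_eqF.
Qed.

Lemma ge0_integral_affine (k c : R) (f : R -> \bar R) : 0 < k ->
  measurable_fun setT f -> (forall x, 0 <= f x)%E ->
  (\int[mu]_x f (k * x + c)%R = (k^-1)%:E * \int[mu]_x f x)%E.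
Proof.
move=> k0 mf f0.
have mk : @measurable_fun _ _ (measurableTypeR R) (measurableTypeR R) setT
     (fun x : R => k * x + c).
  by apply: measurable_funD => //; exact: mulrl_measurable.
pose phi : {mfun measurableTypeR R >-> measurableTypeR R} :=
   HB.pack (fun x : measurableTypeR R => k * x + c : measurableTypeR R)
   (isMeasurableFun.Build _ _ _ _ _ mk).
pose kk := NngNum (ltW k0).
have -> : (\int[mu]_x f x = \int[mscale kk (pushforward mu phi)]_x f x)%E.
  symmetry.
  apply: (@eq_measure_integral _ (measurableTypeR R) R setT mu
    (mscale kk (pushforward mu phi)) f) => A mA _.
  by rewrite /mscale /=; exact: pushforward_affine_lebesgue.
rewrite ge0_integral_mscale //=.
rewrite (@ge0_integral_pushforward _ _ _ _ _ phi) //=.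
by rewrite muleA -EFinM mulVf ?gt_eqF // mul1e.
Qed.

Lemma ge0_integral_even (f : R -> \bar R) :
  measurable_fun setT f -> (forall x, 0 <= f x)%E -> (forall x, f (- x)%R = f x) ->
  (\int[mu]_x f x = 2%:E * \int[mu]_(x in `[0%R, +oo[) f x)%E.
Proof.
move=> mf f0 fe.
have m0 : measurable (`[0%R, +oo[%classic : set R) by exact: measurable_itv.
rewrite -(setUv (`[0%R, +oo[%classic : set R)) ge0_integral_setU//=; last 3 first.
- exact: measurableC.
- by rewrite setUv.
- exact/disj_setPCl.
rewrite mule_natl mule2n; congr +%E.
rewrite setCitvr integral_itv_bndo_bndc; last exact/measurable_funTS.
rewrite ge0_integration_by_substitution0 //.
by apply: eq_integral => x _; rewrite fe.
Qed.

Lemma integral_oneDsqrV : (\int[mu]_x ((oneDsqr x)^-1)%:E = (pi : R)%:E)%E.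
Proof.
rewrite ge0_integral_even.
- rewrite integral0y_oneDsqr -EFinM; congr EFin; by field.
- apply/measurable_EFinP; apply: continuous_measurable_fun.
  exact: continuous_oneDsqrV.
- by move=> x; rewrite lee_fin invr_ge0.
- by move=> x; rewrite /oneDsqr sqrrN.
Qed.

(* Writing y = |x| u and exchanging the integrals, the weight |x| f(|x| w) with
   w = (1 + u^2)^(1/2) rescales to w^-2 |v| f(|v|), and w^-2 integrates to pi. *)
Lemma ge0_integral_radial (f : R -> R) : measurable_fun setT f ->
  (forall x, 0 <= x -> 0 <= f x) ->
  (\int[mu \x mu]_p (f (Num.sqrt (p.1 ^+ 2 + p.2 ^+ 2)))%:E =
   (2 * pi)%:E * \int[mu]_(x in `[0%R, +oo[) (x * f x)%:E)%E.
Proof.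
move=> mf f0.
have msqrt d (T : measurableType d) (g : T -> R) : measurable_fun setT g ->
    measurable_fun setT (fun x => Num.sqrt (g x)).
  move=> mg; apply: measurableT_comp => //.
  by apply: continuous_measurable_fun; exact: sqrt_continuous.
have o0 (u : R) : 0 < oneDsqr u by rewrite (lt_le_trans _ (oneDsqr_ge1 u)).
pose F (p : measurableTypeR R * measurableTypeR R) := f (Num.sqrt (p.1 ^+ 2 + p.2 ^+ 2)).
pose G (p : measurableTypeR R * measurableTypeR R) :=
  `|p.1| * f (`|p.1| * Num.sqrt (oneDsqr p.2)).
pose h (v : R) := `|v| * f `|v|.
have mh : measurable_fun setT h.
  by apply: measurable_funM => //; apply: measurableT_comp.
have h0 v : 0 <= h v by rewrite mulr_ge0 // f0.
have mF : measurable_fun setT (EFin \o F).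
  apply/measurable_EFinP; apply: measurableT_comp => //=; apply: msqrt.
  by apply: measurable_funD; apply: measurable_funX.
have mG : measurable_fun setT (EFin \o G).
  apply/measurable_EFinP; apply: measurable_funM; first exact: measurableT_comp.
  apply: measurableT_comp => //=; apply: measurable_funM; first exact: measurableT_comp.
  apply: msqrt; apply: measurable_funD => //; apply: measurable_funX; exact: measurable_snd.
have F0 p : (0 <= (EFin \o F) p)%E by rewrite /= lee_fin f0 // sqrtr_ge0.
have G0 p : (0 <= (EFin \o G) p)%E
    by rewrite /= lee_fin mulr_ge0 // f0 // mulr_ge0 // sqrtr_ge0.
rewrite (@fubini_tonelli1 _ _ (measurableTypeR R) (measurableTypeR R) R mu mu (EFin \o F)
    mF F0).
transitivity (\int[mu]_x \int[mu]_u (`|x| * f (`|x| * Num.sqrt (oneDsqr u)))%:E)%E.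
  (* The point x = 0 is null, and for x != 0 the substitution y = |x| u is invertible. *)
  rewrite -(@integral_setD1 _ _ 0 setT); last 2 first.
  - exact: measurableD.
  - apply: measurable_funTS; 
    exact: (@measurable_fun_fubini_tonelli_F _ _ (measurableTypeR R)
      (measurableTypeR R) R mu (EFin \o F) mF F0).
  rewrite -[RHS](@integral_setD1 _ _ 0 setT); last 2 first.
  - exact: measurableD.
  - apply: measurable_funTS; 
    exact: (@measurable_fun_fubini_tonelli_F _ _ (measurableTypeR R)
      (measurableTypeR R) R mu (EFin \o G) mG G0).
  apply: eq_integral => x; rewrite inE /= => -[_ /eqP x0].
  (* The summand 0 gives the argument the shape k u + c of [ge0_integral_affine]. *)
  transitivity (\int[mu]_u (`|x|%:E * (f (Num.sqrt (x ^+ 2 + (`|x| * u +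
      0) ^+ 2)))%:E))%E; last first.
    apply: eq_integral => u _; rewrite -EFinM; congr (_ * f _)%:E.
    rewrite addr0 exprMn real_normK ?num_real // -[X in X + _]mulr1 -mulrDr -/(oneDsqr u).
    by rewrite sqrtrM ?sqr_ge0 // sqrtr_sqr.
  have mg : measurable_fun setT (fun y : R => f (Num.sqrt (x ^+ 2 + y ^+ 2))).
    apply: measurableT_comp => //; apply: msqrt.
    by apply: measurable_funD => //; exact: measurable_funX.
  rewrite ge0_integralZl_EFin //; last 2 first.
  - by move=> u _; rewrite lee_fin f0 // sqrtr_ge0.
  - apply/measurable_EFinP; apply: (measurableT_comp mg).
    by apply: measurable_funD => //; exact: mulrl_measurable.
  rewrite (@ge0_integral_affine _ _ (fun y => (f (Num.sqrt (x ^+ 2 +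
      y ^+ 2)))%:E)) ?normr_gt0 //; last 2 first.
  - exact/measurable_EFinP.
  - by move=> y; rewrite lee_fin f0 // sqrtr_ge0.
  by rewrite muleA -EFinM divff ?normr_eq0 // mul1e.
rewrite (@fubini_tonelli _ _ _ _ R mu mu _ mG G0) /G /=.
(* With w = (1 + u^2)^(1/2), writing |x| as w^-1 |w x| gives one factor w^-1, and the rescaling of
   the measure gives the other. *)
transitivity (\int[mu]_u (((oneDsqr u)^-1)%:E * \int[mu]_v (h v)%:E))%E.
  apply: eq_integral => u _.
  have w0 : 0 < Num.sqrt (oneDsqr u) by rewrite sqrtr_gt0.
  have -> : (\int[mu]_x (`|x| * f (`|x| * Num.sqrt (oneDsqr u)))%:E =
     \int[mu]_x (((Num.sqrt (oneDsqr u))^-1)%:E * (h (Num.sqrt (oneDsqr u) * x + 0)%R)%:E))%E.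
    apply: eq_integral => x _; rewrite -EFinM; congr EFin.
    rewrite /h addr0 normrM (ger0_norm (ltW w0)) !mulrA mulVf ?gt_eqF // mul1r.
    by rewrite (mulrC _ `|x|).
  rewrite ge0_integralZl_EFin //; last 2 first.
  - by move=> x _; rewrite lee_fin.
  - apply/measurable_EFinP; apply: measurableT_comp => //.
    by apply: measurable_funD => //; exact: mulrl_measurable.
  rewrite (@ge0_integral_affine _ _ (fun x => (h x)%:E)) //; last exact/measurable_EFinP.
  rewrite muleA -EFinM -invfM -expr2 sqr_sqrtr; last exact: ltW.
  done.
rewrite ge0_integralZr //; last 2 first.
- apply/measurable_EFinP; apply: continuous_measurable_fun.
  exact: continuous_oneDsqrV.
- by apply: integral_ge0 => x _; rewrite lee_fin.
rewrite integral_oneDsqrV ge0_integral_even //; last 2 first.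
- exact/measurable_EFinP.
- by move=> x; rewrite /h normrN.
rewrite muleA -EFinM mulrC; congr (_ * _)%E.
apply: eq_integral => x; rewrite inE /= in_itv /= andbT => x0.
by rewrite /h ger0_norm.
Qed.

End PlaneIntegrals.

Section PowerIntegrals.
Context {R : realType}.
Local Notation mu := (@lebesgue_measure R).
Local Notation C := R[i].

(** Inversion is continuous off 0, and the measurable point 0 is handled apart. *)
Lemma measurable_fun_inv d (T : measurableType d) (f : T -> R) :
  measurable_fun setT f -> measurable_fun setT (fun x => (f x)^-1).
Proof.
move=> mf; apply: (measurableT_comp _ mf).
rewrite -(setUv [set (0 : R)]); apply/measurable_funU => //.
  exact: measurableC.
split; first exact: measurable_fun_set1.
apply: open_continuous_measurable_fun.
  exact: closed_openC.
move=> x; rewrite inE /= => /eqP x0; exact: inv_continuous.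
Qed.

Lemma integral_inv (a b : R) : 0 < a -> a < b ->
  (\int[mu]_(x in `[a, b]) (x^-1)%:E = (ln b - ln a)%:E)%E.
Proof.
move=> a0 ab.
have pos x : x \in `[a, b] -> 0 < x.
  by rewrite in_itv /= => /andP[ax _]; exact: lt_le_trans ax.
rewrite (@continuous_FTC2 _ _ (@ln R)) ?EFinB //.
- apply/continuous_in_subspaceT => x; rewrite inE => /pos x0.
  by apply: inv_continuous; rewrite gt_eqF.
- split.
  + move=> x /subset_itv_oo_cc /pos x0; exact: (@ex_derive _ _ _ _ _ _ _ (is_derive1_ln x0)).
  + by apply: cvg_at_right_filter; exact: continuous_ln.
  + by apply: cvg_at_left_filter; apply: continuous_ln; exact: lt_trans ab.
- move=> x xab; rewrite derive1E.
  have x0 : 0 < x by apply: pos; exact: subset_itv_oo_cc.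
  by have := is_derive1_ln x0 => -[].
Qed.

Lemma integral_inv_sqr_ge (a : R) : 0 < a ->
  (\int[mu]_(x in `[a, +oo[) (x ^- 2)%:E = (a^-1)%:E)%E.
Proof.
move=> a0.
have dinv (x : R) : 0 < x -> is_derive x 1 (fun y : R => - y^-1) (x ^- 2).
  move=> x0.
  have : is_derive x 1 (fun y : R => - y^-1) (- (- x ^- 2 *: 1)).
    by apply: is_deriveN; apply: is_deriveV; rewrite ?gt_eqF.
  by rewrite scaleNr opprK /GRing.scale /= mulr1.
have pos x : a <= x -> x != 0 by move=> ax; rewrite gt_eqF // (lt_le_trans a0 ax).
rewrite (@ge0_continuous_FTC2y _ _ (fun x => - x^-1) _ 0) //.
- by rewrite -EFinD opprK add0r.
- by move=> x _; rewrite invr_ge0 sqr_ge0.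
- apply/continuous_in_subspaceT => x; rewrite inE /= in_itv /= andbT => /pos x0.
  apply: (@cvg_comp _ _ _ (fun x : R => x ^+ 2) GRing.inv).
    exact: exprn_continuous.
  by apply: inv_continuous; rewrite expf_neq0.
- rewrite -oppr0; apply: cvgN; apply/gtr0_cvgV0; last exact: cvg_id.
  exact: nbhs_pinfty_gt.
- by move=> x ax; apply: (@ex_derive _ _ _ _ _ _ _ (dinv x _)); exact: lt_trans ax.
- by apply: cvg_at_right_filter; apply: continuousN; apply: inv_continuous; exact: pos.
- move=> x; rewrite in_itv /= andbT => ax; rewrite derive1E.
  by have := dinv x (lt_trans a0 ax) => -[].
Qed.
End PowerIntegrals.

(** * Radial kernels about a centre *)

Section RadialKernels.
Context {R : realType}.
Local Notation mu := (@lebesgue_measure R).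
Local Notation C := R[i].
Local Notation RR := (measurableTypeR R * measurableTypeR R)%type.

Lemma ge0_integral_plane_translate (a b : R) (g : RR -> \bar R) :
  measurable_fun setT g -> (forall p, 0 <= g p)%E ->
  (\int[mu \x mu]_p g (p.1 + a, p.2 + b)%R = \int[mu \x mu]_p g p)%E.
Proof.
move=> mg g0.
have ma (c : R) : measurable_fun setT (fun x : R => x + c) by apply: measurable_funD.
have mg' : measurable_fun setT (fun p : RR => g (p.1 + a, p.2 + b)).
  apply: (measurableT_comp mg); apply/measurable_fun_pair.
    exact: (measurableT_comp (ma a)).
  exact: (measurableT_comp (ma b) measurable_snd).
rewrite (@fubini_tonelli1 _ _ (measurableTypeR R) (measurableTypeR R) R mu mu _ mg' (fun
    p => g0 _)).
rewrite (@fubini_tonelli1 _ _ (measurableTypeR R) (measurableTypeR R) R mu mu _ mg g0).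
rewrite /fubini_F /=.
transitivity (\int[mu]_x (fubini_F mu g (x + a)%R))%E.
  apply: eq_integral => x _; rewrite /fubini_F.
  have h := @ge0_integral_affine R 1 b (fun y => g (x + a, y)) ltr01
    (measurableT_comp mg (pair1_measurable (x + a))) (fun y => g0 _).
  rewrite -[RHS]mul1e -[in RHS]invr1 -h.
  by apply: eq_integral => y _; rewrite mul1r.
have mFg := @measurable_fun_fubini_tonelli_F _ _ (measurableTypeR R)
  (measurableTypeR R) R mu g mg g0.
have h := @ge0_integral_affine R 1 a (fubini_F mu g) ltr01 mFg
  (fun y => @integral_ge0 _ _ _ mu setT _ (fun u _ => g0 _)).
rewrite -[RHS]mul1e -[in RHS]invr1 -h.
by apply: eq_integral => y _; rewrite mul1r.
Qed.

Lemma cabsE (z : C) : cabs z = Num.sqrt (complex.Re z ^+ 2 + complex.Im z ^+ 2).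
Proof. by case: z. Qed.

Lemma ge0_integral_radial_at (c : C) (f : R -> R) : measurable_fun setT f ->
  (forall x, 0 <= x -> 0 <= f x) ->
  (\int[mu \x mu]_p (f (cabs (p.1 +i* p.2 - c)%C))%:E =
   (2 * pi)%:E * \int[mu]_(x in `[0%R, +oo[) (x * f x)%:E)%E.
Proof.
move=> mf f0; rewrite -ge0_integral_radial //.
rewrite -[RHS](@ge0_integral_plane_translate (- complex.Re c) (- complex.Im c)).
- by apply: eq_integral => p _ /=; rewrite cabsE; case: c.
- apply/measurable_EFinP; apply: measurableT_comp => //=.
  apply: (@measurableT_comp _ _ _ _ _ _ (@Num.sqrt R)).
    by apply: continuous_measurable_fun; exact: sqrt_continuous.
  apply: measurable_funD; apply: measurable_funX => //.
- by move=> p; rewrite lee_fin f0 // sqrtr_ge0.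
Qed.

(** Radial profiles of the majorants: multiplied by the Jacobian x, they integrate to a length, a
    logarithm and an inverse radius. [kernel1] takes the value 0^-1 = 0 at the centre. *)
Definition kernel1 (r x : R) : R := if x < r then x^-1 else 0.
Definition kernel2 (a b x : R) : R := if a <= x <= b then x ^- 2 else 0.
Definition kernel3 (r x : R) : R := if r <= x then x ^- 3 else 0.

Lemma measurable_kernel1 r : measurable_fun setT (kernel1 r).
Proof.
apply: measurable_fun_ifT => //; last exact: measurable_fun_inv.
exact: measurable_fun_ltr.
Qed.

Lemma measurable_kernel2 a b : measurable_fun setT (kernel2 a b).
Proof.
apply: measurable_fun_ifT => //; last first.
  by apply: measurable_fun_inv.
by apply: measurable_and; apply: measurable_fun_ler.
Qed.

Lemma measurable_kernel3 r : measurable_fun setT (kernel3 r).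
Proof.
apply: measurable_fun_ifT => //; last first.
  by apply: measurable_fun_inv.
exact: measurable_fun_ler.
Qed.

Lemma kernel1_ge0 r x : 0 <= x -> 0 <= kernel1 r x.
Proof. by move=> x0; rewrite /kernel1; case: ifP => //; rewrite invr_ge0. Qed.

Lemma kernel2_ge0 a b x : 0 <= x -> 0 <= kernel2 a b x.
Proof. by move=> x0; rewrite /kernel2; case: ifP => //; rewrite invr_ge0 exprn_ge0. Qed.

Lemma kernel3_ge0 r x : 0 <= x -> 0 <= kernel3 r x.
Proof. by move=> x0; rewrite /kernel3; case: ifP => //; rewrite invr_ge0 exprn_ge0. Qed.

(** The Jacobian x cancels x^-1, so that the radial integrand is at most the indicator of [0, r]. *)
Lemma integral_kernel1 (c : C) (r : R) : 0 <= r ->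
  (\int[mu \x mu]_p (kernel1 r (cabs (p.1 +i* p.2 - c)%C))%:E <= (2 * pi * r)%:E)%E.
Proof.
move=> r0; rewrite ge0_integral_radial_at; [|exact: measurable_kernel1|exact: kernel1_ge0].
rewrite [leRHS]EFinM lee_wpmul2l ?lee_fin ?mulr_ge0 ?pi_ge0 //.
apply: (@le_trans _ _ (\int[mu]_(x in `[0%R, +oo[) (\1_`[0, r] x)%:E)%E).
  apply: ge0_le_integral => //=.
  - by move=> x; rewrite in_itv /= andbT => x0; rewrite lee_fin mulr_ge0 ?kernel1_ge0.
  - apply/measurable_EFinP/measurable_funTS/measurable_funM => //.
    exact: measurable_kernel1.
  - by apply/measurable_EFinP; apply: measurable_indic.
  - move=> x; rewrite in_itv /= andbT => x0; rewrite lee_fin /kernel1.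
    case: ifPn => xr; last by rewrite mulr0 indicE; case: (_ \in _).
    rewrite indicE mem_set /=; last by rewrite in_itv /= x0 ltW.
    by have [->|xn0] := eqVneq x 0; rewrite ?mul0r // divff.
rewrite integral_indic //= setIidl; last by apply: subset_itvl.
by rewrite lebesgue_measure_itv /= lte_fin; case: ifP => //; rewrite oppr0 addr0.
Qed.

Lemma integral_kernel2 (c : C) (a b : R) : 0 < a -> a < b ->
  (\int[mu \x mu]_p (kernel2 a b (cabs (p.1 +i* p.2 - c)%C))%:E =
   (2 * pi * (ln b - ln a))%:E)%E.
Proof.
move=> a0 ab; rewrite ge0_integral_radial_at; [|exact: measurable_kernel2|exact: kernel2_ge0].
rewrite [RHS]EFinM; congr (_ * _)%E; rewrite -integral_inv //.
rewrite integral_mkcond [RHS]integral_mkcond; apply: eq_integral => x _.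
rewrite !patchE !mem_setE !in_itv /= andbT /kernel2.
have [x0|x0] := leP 0 x; last first.
  case: ifP => // /andP[ax _]; have := lt_le_trans a0 ax.
  by rewrite ltNge ltW.
case: ifPn => axb; rewrite ?mulr0 //.
case/andP: axb => ax _; have x1 := lt_le_trans a0 ax.
congr EFin; field; exact: lt0r_neq0.
Qed.

Lemma integral_kernel3 (c : C) (r : R) : 0 < r ->
  (\int[mu \x mu]_p (kernel3 r (cabs (p.1 +i* p.2 - c)%C))%:E = (2 * pi / r)%:E)%E.
Proof.
move=> r0; rewrite ge0_integral_radial_at; [|exact: measurable_kernel3|exact: kernel3_ge0].
rewrite [RHS]EFinM; congr (_ * _)%E; rewrite -integral_inv_sqr_ge //.
rewrite integral_mkcond [RHS]integral_mkcond; apply: eq_integral => x _.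
rewrite !patchE !mem_setE !in_itv /= !andbT /kernel3.
have [x0|x0] := leP 0 x; last first.
  case: ifP => // ax; have := lt_le_trans r0 ax.
  by rewrite ltNge ltW.
case: ifPn => axb; rewrite ?mulr0 //.
have x1 := lt_le_trans r0 axb.
congr EFin; field; exact: lt0r_neq0.
Qed.

End RadialKernels.

(** * Asymptotics in t *)

Section Modulus.
Context {R : realType}.
Local Notation C := R[i].
Implicit Types z w : C.

Lemma cabs_ge0 z : 0 <= cabs z.
Proof. by case: z => x y; exact: sqrtr_ge0. Qed.

Lemma cabsM z w : cabs (z * w) = cabs z * cabs w.
Proof. exact: Normc.normcM. Qed.

Lemma cabs0 : cabs (0 : C) = 0.
Proof. exact: Normc.normc0. Qed.

Lemma cabs1 : cabs (1 : C) = 1.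
Proof. exact: Normc.normc1. Qed.

Lemma cabsN z : cabs (- z) = cabs z.
Proof. exact: normcN. Qed.

Lemma cabsV z : cabs z^-1 = (cabs z)^-1.
Proof. exact: Normc.normcV. Qed.

Lemma cabsX z n : cabs (z ^+ n) = cabs z ^+ n.
Proof. by elim: n => [|n IH]; rewrite ?expr0 ?cabs1 // !exprS cabsM IH. Qed.

Lemma cabsD z w : cabs (z + w) <= cabs z + cabs w.
Proof. exact: le_normcD. Qed.

Lemma cabsB z w : cabs (z - w) <= cabs z + cabs w.
Proof. by rewrite -(cabsN w); exact: cabsD. Qed.

Lemma cabsBC z w : cabs (z - w) = cabs (w - z).
Proof. by rewrite -cabsN opprB. Qed.

Lemma ler_cabsB z w : cabs z - cabs w <= cabs (z - w).
Proof. by rewrite lerBlDr -{1}(subrK w z); exact: cabsD. Qed.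

Lemma ler_cabsD z w : cabs z - cabs w <= cabs (z + w).
Proof. by rewrite -(cabsN w) -{2}(opprK w); exact: ler_cabsB. Qed.

Lemma cabs_eq0 z : (cabs z == 0) = (z == 0).
Proof.
apply/eqP/eqP => [/Normc.eq0_normc //|->]; exact: cabs0.
Qed.

Lemma cabs_gt0 z : (0 < cabs z) = (z != 0).
Proof. by rewrite lt_def cabs_ge0 andbT cabs_eq0. Qed.

Lemma cabs_real (x : R) : cabs x%:C = `|x|.
Proof. by rewrite /cabs /= expr0n addr0 sqrtr_sqr. Qed.

Lemma cabs_nat n : cabs (n%:R : C) = n%:R.
Proof. by rewrite -[n%:R in LHS](rmorph_nat (real_complex R)) cabs_real normr_nat. Qed.

Lemma Re_le_cabs z : `|complex.Re z| <= cabs z.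
Proof.
case: z => x y /=; rewrite /cabs /= -sqrtr_sqr ler_sqrt ?addr_ge0 ?sqr_ge0 //.
by rewrite lerDl sqr_ge0.
Qed.

Lemma Im_le_cabs z : `|complex.Im z| <= cabs z.
Proof.
case: z => x y /=; rewrite /cabs /= -sqrtr_sqr ler_sqrt ?addr_ge0 ?sqr_ge0 //.
by rewrite lerDr sqr_ge0.
Qed.

Lemma cabs_le_ReIm z : cabs z <= `|complex.Re z| + `|complex.Im z|.
Proof.
have -> : z = (complex.Re z)%:C + 'i%C * (complex.Im z)%:C by exact: complexE.
rewrite (le_trans (cabsD _ _)) // cabsM !cabs_real.
have -> : cabs ('i%C : C) = 1 by rewrite /cabs /= expr0n expr1n add0r sqrtr1.
by rewrite mul1r -complexE.
Qed.

End Modulus.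

(** * Calculus of O(t^-k) *)

Section AsymptoticCalculus.
Context {R : realType}.
Local Notation C := R[i].
Implicit Types (f g : C -> C) (k j : nat).

(** The index is the order of decay, f(t) = O(t^-k); order 0 is boundedness near infinity. *)
Definition Oh k f := exists K : R, \forall t \near cinfty R, cabs (f t) <= K * cabs t ^- k.

Lemma near_cinfty_gt (r : R) : \forall t \near cinfty R, r < cabs t.
Proof. by exists r. Qed.

Lemma near_cinfty_neq0 : \forall t \near cinfty R, t != 0.
Proof. by near=> t; rewrite -cabs_gt0; near: t; exact: near_cinfty_gt. 
Unshelve. all: end_near. Qed.

Lemma Oh_ge0 k f : Oh k f ->
  exists2 K : R, 0 < K & \forall t \near cinfty R, cabs (f t) <= K * cabs t ^- k.
Proof.
move=> [K HK]; exists (`|K| + 1); first by rewrite ltr_wpDl.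
apply: filterS HK => t /le_trans; apply.
apply: ler_wpM2r; first by rewrite invr_ge0 exprn_ge0 ?cabs_ge0.
by rewrite (le_trans (ler_norm K)) // lerDl.
Qed.

Lemma Oh_near k f g : (\forall t \near cinfty R, f t = g t) -> Oh k f -> Oh k g.
Proof. by move=> fg [K HK]; exists K; near=> t; rewrite -(near fg t) //; near: t.
Unshelve. all: end_near. Qed.

Lemma Oh_ext k f g : f =1 g -> Oh k f -> Oh k g.
Proof. by move=> /funext ->. Qed.

Lemma Oh_cst (c : C) : Oh 0 (fun=> c).
Proof. by exists (cabs c); near=> t; rewrite expr0 invr1 mulr1.
Unshelve. all: end_near. Qed.

Lemma Oh_inv : Oh 1 (fun t => t^-1).
Proof. by exists 1; near=> t; rewrite mul1r expr1 cabsV.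
Unshelve. all: end_near. Qed.

Lemma OhD k f g : Oh k f -> Oh k g -> Oh k (fun t => f t + g t).
Proof.
move=> [K HK] [L HL]; exists (K + L); near=> t.
rewrite (le_trans (cabsD _ _)) // mulrDl lerD //; near: t; [exact: HK|exact: HL].
Unshelve. all: end_near. Qed.

Lemma OhN k f : Oh k f -> Oh k (fun t => - f t).
Proof. by move=> [K HK]; exists K; near=> t; rewrite cabsN; near: t.
Unshelve. all: end_near. Qed.

Lemma OhB k f g : Oh k f -> Oh k g -> Oh k (fun t => f t - g t).
Proof. by move=> Hf Hg; apply: OhD => //; exact: OhN. Qed.

Lemma OhM k j f g : Oh k f -> Oh j g -> Oh (k + j) (fun t => f t * g t).
Proof.
move=> /Oh_ge0[K K0 HK] [L HL]; exists (K * L); near=> t.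
rewrite cabsM exprD invfM mulrACA ler_pM ?cabs_ge0 //; near: t; [exact: HK|exact: HL].
Unshelve. all: end_near. Qed.

Lemma OhMl k (c : C) f : Oh k f -> Oh k (fun t => c * f t).
Proof. by move=> ?; rewrite -(add0n k); apply: OhM => //; exact: Oh_cst. Qed.

Lemma OhX k n f : Oh k f -> Oh (k * n) (fun t => f t ^+ n).
Proof.
move=> Hf; elim: n => [|n IH]; first by rewrite muln0; apply: Oh_ext (Oh_cst 1) => t.
by rewrite mulnS; apply: Oh_ext (OhM Hf IH) => t; rewrite exprS.
Qed.

Lemma OhW k j f : (k <= j)%N -> Oh j f -> Oh k f.
Proof.
move=> kj /Oh_ge0[K K0 HK]; exists K; near=> t.
apply: le_trans (near HK t _) _ => //.
apply: ler_wpM2l; first exact: ltW.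
have t1 : 1 < cabs t by near: t; exact: near_cinfty_gt.
have t0 : 0 < cabs t by apply: lt_trans t1.
by rewrite lef_pV2 ?posrE ?exprn_gt0 // ler_weXn2l // ltW.
Unshelve. all: end_near. Qed.

Lemma Oh_bounded_below (c : R) f : 0 < c ->
  (\forall t \near cinfty R, c <= cabs (f t)) -> Oh 0 (fun t => (f t)^-1).
Proof.
move=> c0 Hf; exists c^-1; near=> t.
have Hft : c <= cabs (f t) by near: t.
by rewrite expr0 invr1 mulr1 cabsV lef_pV2 ?posrE // (lt_le_trans c0).
Unshelve. all: end_near. Qed.

Lemma Oh_small k f (e : R) : Oh k.+1 f -> 0 < e ->
  \forall t \near cinfty R, cabs (f t) <= e.
Proof.
move=> /(@OhW 1 k.+1 _ isT)/Oh_ge0[K K0 HK] e0; near=> t.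
apply: le_trans (near HK t _) _ => //.
have t1 : K / e < cabs t by near: t; exact: near_cinfty_gt.
have t0 : 0 < cabs t by rewrite (lt_trans _ t1) // divr_gt0.
by rewrite expr1 ler_pdivrMr // mulrC -ler_pdivrMr // ltW.
Unshelve. all: end_near. Qed.

(* 1/(1+f) = 1 - f + f^2/(1+f). *)
Lemma Oh_inv1D k f : Oh k.+1 f -> Oh (k.+1 * 2) (fun t => (1 + f t)^-1 - (1 - f t)).
Proof.
move=> Hf.
have H : \forall t \near cinfty R, 2^-1 <= cabs (1 + f t).
  have h := Oh_small Hf (e := 2^-1) ltac:(lra).
  near=> t; have ht : cabs (f t) <= 2^-1 by near: t.
  have := ler_cabsD 1 (f t); rewrite cabs1; lra.
have := OhM (OhX 2 Hf) (Oh_bounded_below (c := 2^-1) ltac:(lra) H).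
rewrite addn0; apply: Oh_near; near=> t.
have h2 : 2^-1 <= cabs (1 + f t) by near: t.
have n0 : 1 + f t != 0 by rewrite -cabs_gt0 (lt_le_trans _ h2) // invr_gt0.
by field.
Unshelve. all: end_near. Qed.

Lemma Oh_inv1D0 k f : Oh k.+1 f -> Oh 0 (fun t => (1 + f t)^-1).
Proof.
move=> Hf.
have h := Oh_small Hf (e := 2^-1) ltac:(lra).
apply: (Oh_bounded_below (c := 2^-1)); first lra.
near=> t; have ht : cabs (f t) <= 2^-1 by near: t.
have := ler_cabsD 1 (f t); rewrite cabs1; lra.
Unshelve. all: end_near. Qed.

End AsymptoticCalculus.

(** Comparison of the coefficients of degree 3, 2, 1, 0. The relations are grouped by the pairs (a,
    b) and (c, d), whose sums and products are estimated separately. *)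
Lemma nut_vieta (R : realType) (mu0 mu1 mu3 t a b c d : R[i]) :
  nut mu0 mu1 mu3 t = mu0 *: (('X - a%:P) * ('X - b%:P) * ('X - c%:P) * ('X - d%:P)) ->
  [/\ mu0 * ((a + b) + (c + d)) = - mu1,
      mu0 * (a * b + c * d + (a + b) * (c + d)) = t,
      mu0 * ((a + b) * (c * d) + (c + d) * (a * b)) = - mu3 &
      mu0 * ((a * b) * (c * d)) = - 1].
Proof.
have -> : ('X - a%:P) * ('X - b%:P) * ('X - c%:P) * ('X - d%:P) =
   (a * b * (c * d))%:P - ((a + b) * (c * d) + (c + d) * (a * b))%:P * 'X
   + (a * b + c * d + (a + b) * (c + d))%:P * 'X^2 - (a + b + (c + d))%:P * 'X^3 + 'X^4.
  rewrite !(rmorphD, rmorphM) /=; ring.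
move=> /polyP H.
have := H 0; have := H 1; have := H 2; have := H 3.
rewrite /nut !(coefD, coefZ, coefN, coefCM, coefC, coefX, coefXn, coef1) /=.
rewrite !(mulr0, mulr1, addr0, add0r, subr0, sub0r, oppr0) => h3 h2 h1 h0.
split.
- by rewrite h3 mulrN opprK.
- by rewrite -h2.
- by rewrite h1 mulrN opprK.
- by rewrite -h0.
Qed.

(** * Sums, products and discriminants of the two pairs of roots *)

Section Vieta.
Context {R : realType}.
Local Notation C := R[i].
Variables (mu0 mu1 mu3 : C) (a b c d : C -> C) (c0 : R).
Hypotheses (mu00 : mu0 != 0) (c00 : 0 < c0).
Hypothesis H : \forall t \near cinfty R, nut mu0 mu1 mu3 t =
  mu0 *: (('X - (a t)%:P) * ('X - (b t)%:P) * ('X - (c t)%:P) * ('X - (d t)%:P)).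
Hypothesis Hcd : \forall t \near cinfty R, c0 * cabs t <= cabs (c t * d t).

(* Rescaled symmetric functions of the pairs (a, b) and (c, d): the relations
   between them have coefficients polynomial in 1/t. *)
Let P1 t := c t * d t / t.
Let p1 t := a t * b t * t.
Let S1 t := (a t + b t) * t.

Let V t := [/\ t != 0 /\ c t * d t != 0,
  a t * b t = - (mu0 * (c t * d t))^-1,
  c t + d t = - mu1 / mu0 - (a t + b t),
  a t * b t + c t * d t + (a t + b t) * (c t + d t) = t / mu0 &
  (a t + b t) * (c t * d t) + (c t + d t) * (a t * b t) = - mu3 / mu0].

Let near_vieta : \forall t \near cinfty R, V t.
Proof.
near=> t.
have t0 : t != 0 by near: t; exact: near_cinfty_neq0.
have cd0 : c t * d t != 0.
  rewrite -cabs_gt0; apply: (@lt_le_trans _ _ (c0 * cabs t)); last by near: t.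
  by rewrite mulr_gt0 // cabs_gt0.
have [v1 v2 v3 v4] : [/\ mu0 * ((a t + b t) + (c t + d t)) = - mu1,
      mu0 * (a t * b t + c t * d t + (a t + b t) * (c t + d t)) = t,
      mu0 * ((a t + b t) * (c t * d t) + (c t + d t) * (a t * b t)) = - mu3 &
      mu0 * ((a t * b t) * (c t * d t)) = - 1].
  by apply: nut_vieta; near: t.
split=> //.
- apply: (mulIf (mulf_neq0 mu00 cd0)); rewrite mulNr mulVf ?(mulf_neq0 mu00 cd0) //.
  by transitivity (mu0 * ((a t * b t) * (c t * d t))); [ring|rewrite v4].
- apply: (mulfI mu00); rewrite mulrBr mulrCA divff // mulr1 -v1; ring.
- apply: (mulfI mu00); by rewrite v2; field.
- apply: (mulfI mu00); by rewrite v3; field.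
Unshelve. all: end_near. Qed.

Let invP1 : Oh 0 (fun t => (P1 t)^-1).
Proof.
apply: (Oh_bounded_below c00); near=> t.
have [[t0 _] _ _ _ _] : V t by near: t.
rewrite /P1 [cabs _]cabsM cabsV ler_pdivlMr ?cabs_gt0 //; near: t; exact: Hcd.
Unshelve. all: end_near. Qed.

(** The product of the four roots is -1 / mu0, so [p1] is -1 / (mu0 P1), and [P1] is bounded away
    from 0. *)
Lemma Oh_small_prod : Oh 0 p1.
Proof.
have h := OhMl (- mu0^-1) invP1; apply: Oh_near h; near=> t.
have [[t0 cd0] Vp _ _ _] : V t by near: t.
move: (cd0); rewrite mulf_eq0 negb_or => /andP[cn dn].
rewrite /P1 /p1 Vp; field; by rewrite ?t0 ?mu00 ?cn ?dn.
Unshelve. all: end_near. Qed.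

(** P1 - t^-2 p1 is the coefficient of [S1] in the linear equation behind [Oh_small_sum]; its second
    term tends to 0. *)
Let invPp : Oh 0 (fun t => (P1 t - t^-1 ^+ 2 * p1 t)^-1).
Proof.
have c20 : 0 < c0 / 2 by rewrite divr_gt0.
have Hs : Oh 2 (fun t => t^-1 ^+ 2 * p1 t).
  have h := OhM (OhX 2 (@Oh_inv R)) Oh_small_prod; exact: h.
apply: (@Oh_bounded_below _ (c0 / 2)); first by rewrite divr_gt0.
have hs := Oh_small Hs c20.
near=> t.
have [[t0 _] _ _ _ _] : V t by near: t.
have hP : c0 <= cabs (P1 t).
  rewrite /P1 cabsM cabsV ler_pdivlMr ?cabs_gt0 //; near: t; exact: Hcd.
have hs' : cabs (t^-1 ^+ 2 * p1 t) <= c0 / 2 by near: t; exact: hs.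
have := ler_cabsB (P1 t) (t^-1 ^+ 2 * p1 t); lra.
Unshelve. all: end_near. Qed.

(** Eliminating c + d from the relation with mu3 leaves S1 (P1 - t^-2 p1) = - mu3 / mu0 + (mu1 /
    mu0) t^-1 p1. *)
Lemma Oh_small_sum : Oh 0 S1.
Proof.
have h1 : Oh 0 (fun t => - mu3 / mu0 + mu1 / mu0 * (t^-1 * p1 t)).
  apply: OhD; first exact: Oh_cst.
  by apply: (@OhW _ _ 1) => //; apply: OhMl; exact: (OhM (@Oh_inv R) Oh_small_prod).
have h := OhM h1 invPp; rewrite addn0 in h; apply: Oh_near h.
have hn : \forall t \near cinfty R, P1 t - t^-1 ^+ 2 * p1 t != 0.
  have c20 : 0 < c0 / 2 by rewrite divr_gt0.
  have hs := Oh_small (OhM (OhX 2 (@Oh_inv R)) Oh_small_prod) c20.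
  near=> t.
  have [[t0 _] _ _ _ _] : V t by near: t.
  have hP : c0 <= cabs (P1 t).
    rewrite /P1 cabsM cabsV ler_pdivlMr ?cabs_gt0 //; near: t; exact: Hcd.
  have hs' : cabs (t^-1 ^+ 2 * p1 t) <= c0 / 2 by near: t; exact: hs.
  rewrite -cabs_gt0; have := ler_cabsB (P1 t) (t^-1 ^+ 2 * p1 t); lra.
near=> t.
have [[t0 _] _ VS _ V3] : V t by near: t.
have n0 : P1 t - t^-1 ^+ 2 * p1 t != 0 by near: t.
apply: (mulIf n0); rewrite mulfVK //.
have -> : - mu3 / mu0 = (a t + b t) * (c t * d t) + (- mu1 / mu0 - (a t + b t)) * (a t * b t).
  by rewrite -V3 VS.
by rewrite /S1 /P1 /p1; field; rewrite ?t0 ?mu00.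
Unshelve. all: end_near. Qed.

(** This is c + d, written through [S1]. *)
Let S' t := - mu1 / mu0 - t^-1 * S1 t.
Let OhS' : Oh 0 S'.
Proof.
apply: OhB; first exact: Oh_cst.
by apply: (@OhW _ _ 1) => //; exact: (OhM (@Oh_inv R) Oh_small_sum).
Qed.

(** The relation with t, divided by t, reads P1 - 1 / mu0 = - t^-2 (p1 + S1 S'), and the bracket is
    bounded. *)
Lemma Oh_large_prod : Oh 2 (fun t => P1 t - mu0^-1).
Proof.
have h : Oh 2 (fun t => - (t^-1 ^+ 2 * (p1 t + S1 t * S' t))).
  apply: OhN; have := OhM (OhX 2 (@Oh_inv R)) (OhD Oh_small_prod (OhM Oh_small_sum
      OhS')); exact.
apply: Oh_near h; near=> t.
have [[t0 _] _ VS V2 _] : V t by near: t.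
have -> : mu0^-1 = (a t * b t + c t * d t + (a t + b t) * (- mu1 / mu0 - (a t + b t))) / t.
  by rewrite -VS V2; field; rewrite ?t0 ?mu00.
by rewrite /S' /S1 /P1 /p1; field; rewrite ?t0 ?mu00.
Unshelve. all: end_near. Qed.

Lemma Oh_small_prod1 : Oh 2 (fun t => p1 t + 1).
Proof.
have h := OhM Oh_large_prod invP1; rewrite addn0 in h; apply: Oh_near h; near=> t.
have [[t0 cd0] Vp _ _ _] : V t by near: t.
move: (cd0); rewrite mulf_eq0 negb_or => /andP[cn dn].
by rewrite /P1 /p1 Vp; field; rewrite ?t0 ?mu00 ?cn ?dn.
Unshelve. all: end_near. Qed.

(** The equation for [S1] is multiplied by mu0; by now mu0 P1 = 1 + O(t^-2). *)
Lemma Oh_small_sum1 : Oh 1 (fun t => S1 t + mu3).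
Proof.
have h : Oh 1 (fun t => mu1 * (t^-1 * p1 t) - mu0 * (S1 t * ((P1 t - mu0^-1) - t^-1 ^+ 2
    * p1 t))).
  apply: OhB; apply: OhMl; first exact: (OhM (@Oh_inv R) Oh_small_prod).
  apply: (@OhW _ _ 2) => //; apply: (OhM Oh_small_sum); apply: OhB; first exact: Oh_large_prod.
  exact: (OhM (OhX 2 (@Oh_inv R)) Oh_small_prod).
apply: Oh_near h; near=> t.
have [[t0 _] _ VS _ V3] : V t by near: t.
have -> : mu3 = - mu0 * ((a t + b t) * (c t * d t) + (- mu1 / mu0 - (a t + b t)) * (a t * b t)).
  by rewrite -VS V3; field.
by rewrite /S1 /P1 /p1; field; rewrite ?t0 ?mu00.
Unshelve. all: end_near. Qed.

(** (a - b)^2 = (a + b)^2 - 4 a b gives S1^2 / (4 t) - p1, where S1^2 - mu3^2 = (S1 - mu3)(S1 + mu3)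
    is O(t^-1) and p1 = -1 + O(t^-2). *)
Lemma Oh_small_discr : Oh 2 (fun t =>
  (a t - b t) ^+ 2 * t / 4 - (1 + mu3 ^+ 2 / 4 * t^-1)).
Proof.
have h : Oh 2 (fun t => 4^-1 * (t^-1 * ((S1 t - mu3) * (S1 t + mu3))) - (p1 t + 1)).
  apply: OhB Oh_small_prod1; apply: OhMl; apply: (@OhM _ 1 1); first exact: Oh_inv.
  apply: (@OhM _ 0 1); last exact: Oh_small_sum1.
  apply: OhB; [exact: Oh_small_sum|exact: Oh_cst].
apply: Oh_near h; near=> t.
have [[t0 _] _ _ _ _] : V t by near: t.
by rewrite /S1 /p1; field; rewrite ?t0 ?mu00.
Unshelve. all: end_near. Qed.

(** The same identity for c and d leaves mu0 P1 and a multiple of t^-1 (c + d)^2, and c + d differs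
    from - mu1 / mu0 by t^-1 S1. *)
Lemma Oh_large_discr : Oh 2 (fun t =>
  (c t - d t) ^+ 2 * (- mu0 / 4) * t^-1 - (1 - mu1 ^+ 2 / (4 * mu0) * t^-1)).
Proof.
have h : Oh 2 (fun t => mu0 * (P1 t - mu0^-1) - mu0 / 4 * (t^-1 * ((S' t - mu1 / mu0) *
    (- (t^-1 * S1 t))))).
  apply: OhB; apply: OhMl; first exact: Oh_large_prod.
  apply: (@OhM _ 1 1); first exact: Oh_inv.
  apply: (@OhM _ 0 1); first by apply: OhB; [exact: OhS'|exact: Oh_cst].
  by apply: OhN; exact: (OhM (@Oh_inv R) Oh_small_sum).
apply: Oh_near h; near=> t.
have [[t0 _] _ VS _ _] : V t by near: t.
have -> : (c t - d t) ^+ 2 = (- mu1 / mu0 - (a t + b t)) ^+ 2 - 4 * (c t * d t)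
    by rewrite -VS; ring.
by rewrite /S' /S1 /P1; field; rewrite ?t0 ?mu00.
Unshelve. all: end_near. Qed.

End Vieta.

(** * Exponential, theta functions and logarithm *)

Section ComplexExponential.
Context {R : realType}.
Local Notation C := R[i].
Implicit Types z w : C.

Lemma cexpD z w : cexp (z + w) = cexp z * cexp w.
Proof.
case: z w => [a b] [x y]; rewrite /cexp /= expRD sinD cosD.
by apply/eqP; rewrite eq_complex /=; apply/andP; split; apply/eqP; ring.
Qed.

Lemma cabs_cexp z : cabs (cexp z) = expR (complex.Re z).
Proof.
rewrite /cexp cabsM cabs_real ger0_norm ?expR_ge0 //.
by rewrite [cabs _]/cabs /= cos2Dsin2 sqrtr1 mulr1.
Qed.

Lemma cexp_neq0 z : cexp z != 0.
Proof. by rewrite -cabs_gt0 cabs_cexp expR_gt0. Qed.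

Lemma cexp0 : cexp (0 : C) = 1.
Proof. by rewrite /cexp /= expR0 cos0 sin0 mul1r. Qed.

Lemma cexpMn z n : cexp (n%:R * z) = cexp z ^+ n.
Proof.
elim: n => [|n IH]; first by rewrite mul0r cexp0 expr0.
by rewrite -addn1 natrD mulrDl mul1r cexpD IH exprD expr1.
Qed.

Lemma cexpN z : cexp (- z) = (cexp z)^-1.
Proof.
by apply: (mulIf (cexp_neq0 z)); rewrite -cexpD addNr cexp0 mulVf // cexp_neq0.
Qed.

Lemma ReD z w : complex.Re (z + w) = complex.Re z + complex.Re w.
Proof. by case: z w => ? ? []. Qed.
Lemma ImD z w : complex.Im (z + w) = complex.Im z + complex.Im w.
Proof. by case: z w => ? ? []. Qed.

Lemma sum_half_le2 (m n : nat) : \sum_(m <= i < n) (2^-1 : R) ^+ i <= 2.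
Proof.
have h : \sum_(0 <= i < n) (2^-1 : R) ^+ i = 2 - 2 * 2^-1 ^+ n.
  elim: n => [|n IH]; first by rewrite big_nil expr0; lra.
  by rewrite big_nat_recr //= IH exprS; field.
have p k : 0 <= (2^-1 : R) ^+ k by rewrite exprn_ge0 // invr_ge0.
have [mn|nm] := leqP m n; last by rewrite big_geq // ltnW.
have h0 : 0 <= \sum_(0 <= i < m) (2^-1 : R) ^+ i by apply: sumr_ge0 => i _.
move: h; rewrite (big_cat_nat (n := m)) //=; have := p n; lra.
Qed.

Lemma cvg_geometric_series (v : nat -> R) (B : R) :
  (forall n, `|v n| <= B * 2^-1 ^+ n) -> cvgn (fun N => \sum_(0 <= n < N) v n).
Proof.
move=> hv; apply: normed_cvg; apply: (series_le_cvg _ _ hv).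
- by move=> n; exact: normr_ge0.
- by move=> n; apply: le_trans (hv n).
- apply: is_cvg_geometric_series; rewrite ger0_norm; lra.
Qed.

(** A only serves convergence, while B measures the tail after m terms. Limits are taken on real and
    imaginary parts, and each contributes an error 2 B. *)
Lemma climn_series_le (u : nat -> C) (m : nat) (A B : R) :
  (forall n, cabs (u n) <= A * 2^-1 ^+ n) ->
  (forall n, (m <= n)%N -> cabs (u n) <= B * 2^-1 ^+ n) ->
  cabs (climn (fun N => \sum_(0 <= n < N) u n) - \sum_(0 <= n < m) u n) <= 4 * B.
Proof.
move=> hA hB.
have B0 : 0 <= B.
  have := le_trans (cabs_ge0 _) (hB m (leqnn m)).
  by rewrite pmulr_lge0 // exprn_gt0 // invr_gt0.
have tail N : (m <= N)%N ->
    cabs (\sum_(0 <= n < N) u n - \sum_(0 <= n < m) u n) <= 2 * B.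
  move=> mN; rewrite (big_cat_nat (n := m)) //= (addrC (\sum_(0 <= n < m) u n)) addrK.
  apply: (@le_trans _ _ (\sum_(m <= i < N) B * 2^-1 ^+ i)).
    rewrite big_nat [leRHS]big_nat.
    elim/big_ind2: _ => [|x1 x2 y1 y2 h1 h2|i /andP[mi _]]; first by rewrite cabs0.
      by apply: le_trans (cabsD _ _) _; exact: lerD.
    exact: hB.
  by rewrite -mulr_sumr mulrC ler_wpM2r // sum_half_le2.
(* Here [p] is the real or the imaginary part; the bound on the partial sums passes to the limit. *)
have close (p : C -> R) :
    (forall z w, p (z + w) = p z + p w) -> p 0 = 0 -> (forall z, `|p z| <= cabs z) ->
    `|limn (fun N => p (\sum_(0 <= n < N) u n)) - p (\sum_(0 <= n < m) u n)| <= 2 * B.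
  move=> pD p0 pn.
  have pB z w : p (z - w) = p z - p w.
    by apply/eqP; rewrite -subr_eq opprK -pD subrK.
  have cv : cvgn (fun N => p (\sum_(0 <= n < N) u n)).
    under eq_fun do rewrite (big_morph p pD p0).
    by apply: (@cvg_geometric_series _ A) => n; exact: le_trans (pn _) (hA n).
  have bd N : (m <= N)%N -> `|p (\sum_(0 <= n < N) u n) - p (\sum_(0 <= n < m) u n)| <= 2 * B.
    by move=> mN; rewrite -pB; exact: le_trans (pn _) (tail N mN).
  rewrite ler_norml; apply/andP; split.
    rewrite lerBrDr; apply: limr_ge => //; near=> N.
    have : (m <= N)%N by near: N; exists m.
    by move=> /bd; rewrite ler_norml => /andP[]; rewrite lerBrDr.
  rewrite lerBlDr; apply: limr_le => //; near=> N.
  have : (m <= N)%N by near: N; exists m.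
  by move=> /bd; rewrite ler_norml => /andP[_]; rewrite lerBlDr.
apply: le_trans (cabs_le_ReIm _) _.
rewrite (_ : 4 * B = 2 * B + 2 * B); last by ring.
apply: lerD.
  have := close (@complex.Re R) ReD erefl (@Re_le_cabs R).
  by rewrite /climn; case: (\sum_(0 <= n < m) u n).
have := close (@complex.Im R) ImD erefl (@Im_le_cabs R).
by rewrite /climn; case: (\sum_(0 <= n < m) u n).
Unshelve. all: end_near. Qed.

End ComplexExponential.

(** * First terms of the theta functions and of lambda *)

Section Theta.
Context {R : realType}.
Local Notation C := R[i].

Definition nome (tau : C) : C := cexp ('i%C * pi%:C * tau).

Lemma cabs_nome tau : cabs (nome tau) = expR (- (pi * complex.Im tau)).
Proof.
rewrite /nome cabs_cexp; congr expR; case: tau => x y /=.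
by ring.
Qed.

Lemma exprn_half_le (x : R) (k n : nat) : 0 <= x <= 2^-1 -> (n <= k)%N ->
  x ^+ k <= 2^-1 ^+ n.
Proof.
move=> /andP[x0 x1] nk; apply: (@le_trans _ _ (2^-1 ^+ k)); first
    by rewrite lerXn2r // nnegrE invr_ge0.
by rewrite ler_wiXn2l //; lra.
Qed.

(** For n >= 2 the exponents satisfy n^2 - 2 >= n, so a factor q^2 splits off and the rest still
    decays like 2^-n. *)
Lemma theta3_expansion tau : cabs (nome tau) <= 2^-1 ->
  cabs (theta3 tau - (1 + 2 * nome tau)) <= 8 * cabs (nome tau) ^+ 2.
Proof.
set q := nome tau => q2.
have q01 : 0 <= cabs q <= 2^-1 by rewrite cabs_ge0.
(* The term of index 0 is set to 0, as the series in [theta3] starts at index 1. *)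
pose u n : C := if n == 0%N then 0 else q ^+ (n ^ 2).
have h1 n : cabs (u n) <= 1 * 2^-1 ^+ n.
  rewrite mul1r /u; case: eqP => [_|n0]; first by rewrite cabs0 exprn_ge0 // invr_ge0.
  by rewrite cabsX exprn_half_le //; nia.
have h2 n : (2 <= n)%N -> cabs (u n) <= cabs q ^+ 2 * 2^-1 ^+ n.
  move=> n2; rewrite /u; case: eqP => [n0|_]; first by rewrite n0 in n2.
  have -> : (n ^ 2 = 2 + (n ^ 2 - 2))%N by nia.
  rewrite cabsX exprD ler_wpM2l ?exprn_ge0 ?cabs_ge0 // exprn_half_le //; nia.
have := climn_series_le h1 h2.
have -> : \sum_(0 <= n < 2) u n = q.
  by rewrite !big_nat_recr //= big_geq //= /u /= !add0r.
move=> h.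
have -> : theta3 tau - (1 + 2 * q) = 2 * (climn (fun N => \sum_(0 <= n < N) u n) - q).
  rewrite /theta3 [X in climn X](_ : _ = (fun N => \sum_(0 <= n < N) u n)); first by ring.
  apply/funext => -[|N]; first by rewrite !big_geq.
  rewrite [RHS]big_ltn // {1}/u /= add0r !big_nat; apply: eq_bigr => n /andP[n1 _].
  rewrite /u; case: eqP => [n0|_]; first by rewrite n0 in n1.
  rewrite /q /nome -cexpMn natrX; congr cexp; ring.
rewrite cabsM cabs_nat; lra.
Qed.

(** Since (n + 1/2)^2 = 1/4 + n (n + 1), the series is [e], the fourth root of q singled out by tau,
    times powers of q with exponents 0, 2, 6, and so on. *)
Lemma theta2_expansion tau : cabs (nome tau) <= 2^-1 ->
  let e := cexp ('i%C * pi%:C * 4^-1 * tau) in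
  e ^+ 4 = nome tau /\
  cabs (theta2 tau / (2 * e) - 1) <= 8 * cabs (nome tau) ^+ 2.
Proof.
set q := nome tau => q2 e; split.
  by rewrite /e -cexpMn; congr cexp; field.
have e0 : e != 0 by exact: cexp_neq0.
have q01 : 0 <= cabs q <= 2^-1 by rewrite cabs_ge0.
pose u n : C := e * q ^+ (n * n.+1).
have h1 n : cabs (u n) <= cabs e * 2^-1 ^+ n.
  by rewrite /u cabsM cabsX ler_wpM2l ?cabs_ge0 // exprn_half_le //; nia.
(* For n >= 1, n (n + 1) - 2 >= n - 1; the shift by one costs the factor 2. *)
have h2 n : (1 <= n)%N -> cabs (u n) <= (2 * cabs e * cabs q ^+ 2) * 2^-1 ^+ n.
  case: n => // n _; rewrite /u cabsM cabsX.
  have -> : (n.+1 * n.+2 = 2 + (n.+1 * n.+2 - 2))%N by nia.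
  rewrite exprD mulrCA [leRHS](_ : _ = cabs q ^+ 2 * (cabs e * 2^-1 ^+ n)); last
      by rewrite (exprS _ n); field.
  rewrite ler_wpM2l ?exprn_ge0 ?cabs_ge0 // ler_wpM2l ?cabs_ge0 // exprn_half_le //; nia.
have := climn_series_le h1 h2.
set c := climn _; have -> : \sum_(0 <= n < 1) u n = e by rewrite big_nat1 /u mul0n expr0 mulr1.
move=> h.
have -> : theta2 tau = 2 * c.
  rewrite /theta2 /c; congr (2 * climn _); apply/funext => N; apply: eq_bigr => n _.
  by rewrite /u /e /q /nome -cexpMn -cexpD natrM -natr1; congr cexp; field.
rewrite [X in cabs X](_ : _ = (c - e) / e); last by field.
rewrite cabsM cabsV ler_pdivrMr ?cabs_gt0 //; lra.
Qed.

(** This is lambda / (16 q), where [r2] is the error of theta_2 / (2 q^(1/4)) against 1 and [r3]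
    that of theta_3 against 1 + 2 q. *)
Definition theta_ratio (tau r2 r3 : C) : C := ((1 + r2) / (1 + (2 * nome tau + r3))) ^+ 4.

Lemma modular_lambda_expansion tau : cabs (nome tau) <= 2^-1 ->
  exists r : C * C, [/\ cabs r.1 <= 8 * cabs (nome tau) ^+ 2,
    cabs r.2 <= 8 * cabs (nome tau) ^+ 2 &
    modular_lambda tau = 16 * nome tau * theta_ratio tau r.1 r.2].
Proof.
move=> q2; have h3 := theta3_expansion q2; have [e4 h2] := theta2_expansion q2.
move: e4 h2; set e := cexp _ => e4 h2.
exists (theta2 tau / (2 * e) - 1, theta3 tau - (1 + 2 * nome tau)); split => //=.
have e0 : e != 0 by exact: cexp_neq0.
rewrite /modular_lambda /theta_ratio.
have -> : 1 + (2 * nome tau + (theta3 tau - (1 + 2 * nome tau))) = theta3 tau by ring.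
have -> : 1 + (theta2 tau / (2 * e) - 1) = theta2 tau / (2 * e) by ring.
rewrite -e4 !expr_div_n exprMn.
by set y := (theta3 tau ^+ 4)^-1; field.
Qed.

End Theta.

(** * A logarithm near 1 *)

Section ComplexLogarithm.
Context {R : realType}.
Local Notation C := R[i].

(** By the mean value theorem, v - atan v = v c^2 / (1 + c^2) for some c in [0, v]. *)
Lemma atan_sub_ge0 (v : R) : 0 <= v -> 0 <= v - atan v <= v ^+ 3.
Proof.
move=> v0.
have ca : {within `[0, v], continuous (@atan R)}.
  by apply: continuous_subspaceT => x; exact: continuous_atan.
have [c] := MVT_segment v0 (fun x _ => is_derive1_atan x) ca.
rewrite in_itv /= atan0 !subr0 => /andP[c0 cv] ->.
have c2 : 0 < 1 + c ^+ 2 by rewrite ltr_wpDr // sqr_ge0.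
have -> : v - (1 + c ^+ 2)^-1 * v = v * c ^+ 2 / (1 + c ^+ 2) by field; exact: lt0r_neq0.
apply/andP; split; first by rewrite divr_ge0 ?mulr_ge0 ?sqr_ge0 // ltW.
rewrite ler_pdivrMr // exprS.
apply: (@le_trans _ _ (v * v ^+ 2)).
  by apply: ler_wpM2l => //; rewrite ler_sqr ?nnegrE.
by rewrite ler_peMr ?mulr_ge0 ?sqr_ge0 // lerDl sqr_ge0.
Qed.

Lemma atan_sub (v : R) : `|atan v - v| <= `|v| ^+ 3.
Proof.
have [v0|v0] := leP 0 v.
  have := atan_sub_ge0 v0 => /andP[h1 h2].
  by rewrite distrC ger0_norm // ger0_norm.
have v1 : 0 <= - v by lra.
have := atan_sub_ge0 v1; rewrite atanN => /andP[h1 h2].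
rewrite (ltr0_norm v0) ger0_norm; lra.
Qed.

(** With w = x + i y the real part of 1 + w is positive, so ln |1 + w| + i atan (y / (1 + x)) is a
    logarithm. The constant 5 adds 2 for the real part, 1 for atan v - v and 2 for v - y. *)
Lemma clog1D (w : C) : cabs w <= 4^-1 ->
  exists2 l : C, cexp l = 1 + w & cabs (l - w) <= 5 * cabs w ^+ 2.
Proof.
move=> w4; set p := cabs w in w4 *.
have p0 : 0 <= p by exact: cabs_ge0.
have hx : `|complex.Re w| <= p by exact: Re_le_cabs.
have hy : `|complex.Im w| <= p by exact: Im_le_cabs.
have p2 : p ^+ 2 = complex.Re w ^+ 2 + complex.Im w ^+ 2.
  by rewrite /p; case: (w) => x y /=; rewrite sqr_sqrtr // addr_ge0 ?sqr_ge0.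
case: w @p p0 w4 hx hy p2 => x y p p0 w4 /= hx hy p2.
have [hx1 hx2] : - p <= x /\ x <= p by apply/andP; rewrite -ler_norml.
have x1 : 0 < 1 + x by lra.
pose v := y / (1 + x).
have v2 : 0 < 1 + v ^+ 2 by rewrite ltr_wpDr // sqr_ge0.
(* [m] is |1 + w|. It lies between 1 + x and 1 + x + y^2, and 1 - 1 / m <= ln m <= m - 1. *)
pose m := (1 + x) * Num.sqrt (1 + v ^+ 2).
have m0 : 0 < m by rewrite mulr_gt0 // sqrtr_gt0.
have m2 : m ^+ 2 = (1 + x) ^+ 2 + y ^+ 2.
  rewrite /m exprMn sqr_sqrtr; last exact: ltW.
  by rewrite /v; field; exact: lt0r_neq0.
exists (ln m +i* atan v).
  rewrite /cexp /= lnK ?posrE // cos_atan.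
  have ct : cos (atan v) != 0 by rewrite cos_atan invr_eq0 gt_eqF // sqrtr_gt0.
  have -> : sin (atan v) = v / Num.sqrt (1 + v ^+ 2).
    by rewrite -cos_atan -{2}(atanK v) /tan mulfVK.
  have s0 : Num.sqrt (1 + v ^+ 2) != 0 by rewrite gt_eqF // sqrtr_gt0.
  apply/eqP; rewrite eq_complex /= !mul0r subr0 addr0 add0r; apply/andP; split; apply/eqP.
    by rewrite /m; field.
  have -> : m * (v / Num.sqrt (1 + v ^+ 2)) = (1 + x) * v by rewrite /m; field.
  by rewrite /v; field; exact: lt0r_neq0.
have m1 : 1 + x <= m.
  rewrite -(@ler_pXn2r _ 2) ?nnegrE ?(ltW m0) ?(ltW x1) // m2 lerDl sqr_ge0 //.
have m3 : m <= 1 + x + y ^+ 2.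
  have y2 := sqr_ge0 y.
  rewrite -(@ler_pXn2r _ 2) ?nnegrE ?(ltW m0) // ?m2; nra.
have l1 : ln m <= m - 1.
  by have := @le_ln1Dx _ (m - 1); rewrite addrCA subrr addr0; apply; lra.
have l2 : 1 - m^-1 <= ln m.
  have mi : 0 < m^-1 by rewrite invr_gt0.
  have := @le_ln1Dx _ (m^-1 - 1); rewrite addrCA subrr addr0 lnV ?posrE // => h.
  have : - ln m <= m^-1 - 1 by apply: h; lra.
  lra.
have l3 : x - 2 * x ^+ 2 <= 1 - m^-1.
  have : m^-1 <= (1 + x)^-1 by rewrite lef_pV2 ?posrE.
  have : (1 + x)^-1 <= 1 - x + 2 * x ^+ 2.
    rewrite -[leLHS]mul1r ler_pdivrMr //; nra.
  lra.
have x2 := sqr_ge0 x; have y2 := sqr_ge0 y.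
have hRe : `|ln m - x| <= 2 * p ^+ 2 by rewrite ler_norml; apply/andP; split; lra.
have vp : `|v| <= 4 / 3 * p.
  rewrite /v normrM normfV (gtr0_norm x1) ler_pdivrMr //; nra.
have hIm1 : `|atan v - v| <= p ^+ 2.
  apply: le_trans (atan_sub v) _.
  have := normr_ge0 v; move: vp; move: `|v| => V vp V0.
  have V2 : V ^+ 2 <= (4 / 3 * p) ^+ 2 by rewrite ler_sqr ?nnegrE; lra.
  have V3 : V <= 3^-1 by lra.
  rewrite exprSr; nra.
have hIm2 : `|v - y| <= 2 * p ^+ 2.
  have -> : v - y = - (v * x) by rewrite /v; field; exact: lt0r_neq0.
  rewrite normrN normrM.
  have := normr_ge0 v; have := normr_ge0 x; nra.
apply: le_trans (cabs_le_ReIm _) _ => /=.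
have := ler_normD (atan v - v) (v - y).
rewrite addrA subrK; lra.
Qed.

End ComplexLogarithm.

(** * The modulus *)

Lemma cequiv_near (R : realType) (f g : R[i] -> R[i]) (e : R) : 0 < e -> cequiv f g ->
  \forall t \near cinfty R, cabs (f t / g t - 1) <= e.
Proof.
move=> e0 /cvgr0Pnorm_le /(_ e e0); apply: filterS => t.
by rewrite ger0_norm ?cabs_ge0.
Qed.

Section ModulusAsymptotics.
Context {R : realType}.
Local Notation C := R[i].
Variables (mu0 mu1 mu3 s : C) (sq a b c d : C -> C).
Hypotheses (mu00 : mu0 != 0) (hs : s ^+ 2 = - mu0) (hsq : forall t, sq t ^+ 2 = t).
Hypothesis lab : labelled_roots mu0 mu1 mu3 s sq a b c d.

Let s0 : s != 0.
Proof. by apply: contraNneq mu00 => s0; rewrite -oppr_eq0 -hs s0 expr0n. Qed.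

(** [kappa] will be the coefficient of t^-1 in 1 / x, where [x] is the product of root differences
    rescaled to tend to 1; [w] is 1 / (t l) for the cross-ratio l. *)
Let kappa := (mu1 ^+ 2 - mu0 * mu3 ^+ 2) / (8 * mu0).
Let x t := (a t - b t) * (c t - d t) * s / 4.
Let w t := t^-1 * ((c t - b t) * (a t - d t)) / ((a t - b t) * (c t - d t)).

Let c0 : R := (4 * cabs s ^+ 2)^-1.
Let c00 : 0 < c0.
Proof. by rewrite invr_gt0 mulr_gt0 // exprn_gt0 // cabs_gt0. Qed.

(** The tolerance 1/10 keeps the product of two factors 1 + e above 1/4 in modulus, and [x] within
    1/2 of 1. *)
Let lbl t := [/\ t != 0, sq t != 0 &
  exists e : C * C * (C * C),
  [/\ cabs e.1.1 <= 10^-1 /\ a t = (1 + e.1.1) / sq t,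
      cabs e.1.2 <= 10^-1 /\ b t = - (1 + e.1.2) / sq t,
      cabs e.2.1 <= 10^-1 /\ c t = (1 + e.2.1) * sq t / s &
      cabs e.2.2 <= 10^-1 /\ d t = - (1 + e.2.2) * sq t / s]].

Let near_labels : \forall t \near cinfty R, lbl t.
Proof.
have [_ h1 h2 h3 h4] := lab.
have t1 : 0 < 10^-1 :> R by rewrite invr_gt0.
have n1 := cequiv_near t1 h1; have n2 := cequiv_near t1 h2.
have n3 := cequiv_near t1 h3; have n4 := cequiv_near t1 h4.
near=> t.
have t0 : t != 0 by near: t; exact: near_cinfty_neq0.
have q0 : sq t != 0 by apply: contraNneq t0 => h; rewrite -(hsq t) h expr0n.
split => //; exists ((a t / (sq t)^-1 - 1, b t / (- (sq t)^-1) - 1),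
  (c t / (s^-1 * sq t) - 1, d t / (- (s^-1 * sq t)) - 1)); split; split => /=.
- by near: t; exact: n1.
- by field.
- by near: t; exact: n2.
- by field.
- by near: t; exact: n3.
- by field; rewrite q0 s0.
- by near: t; exact: n4.
- by field; rewrite q0 s0.
Unshelve. all: end_near. Qed.

Lemma labelled_large_prod : \forall t \near cinfty R, c0 * cabs t <= cabs (c t * d t).
Proof.
near=> t.
have [t0 q0 [e [_ _ [e3 ->] [e4 ->]]]] : lbl t by near: t; exact: near_labels.
have -> : (1 + e.2.1) * sq t / s * (- (1 + e.2.2) * sq t / s) =
    - ((1 + e.2.1) * (1 + e.2.2) * (t / s ^+ 2)).
  by rewrite -[in RHS](hsq t); field.
rewrite cabsN !cabsM cabsV cabsX /c0.
have e3' := ler_cabsD 1 e.2.1; have e4' := ler_cabsD 1 e.2.2.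
rewrite cabs1 in e3' e4'.
have : 4^-1 <= cabs (1 + e.2.1) * cabs (1 + e.2.2) by nra.
have T0 : 0 <= cabs t / cabs s ^+ 2 by rewrite divr_ge0 ?cabs_ge0 // exprn_ge0 ?cabs_ge0.
move=> h; apply: le_trans (ler_wpM2r T0 h).
by rewrite invfM -mulrA (mulrC _ (cabs t)).
Unshelve. all: end_near. Qed.

Let H : \forall t \near cinfty R, nut mu0 mu1 mu3 t =
  mu0 *: (('X - (a t)%:P) * ('X - (b t)%:P) * ('X - (c t)%:P) * ('X - (d t)%:P)).
Proof. by case: lab. Qed.

Let x_near1 : \forall t \near cinfty R, cabs (x t - 1) <= 2^-1.
Proof.
near=> t.
have [t0 q0 [e [[e1 ea] [e2 eb] [e3 ec] [e4 ed]]]] : lbl t by near: t; exact: near_labels.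
have -> : x t - 1 = 2^-1 * (e.1.1 + e.1.2) + 2^-1 * (e.2.1 + e.2.2) + 4^-1 * ((e.1.1 +
    e.1.2) * (e.2.1 + e.2.2)).
  by rewrite /x ea eb ec ed; field; rewrite q0 s0.
have h1 := cabsD e.1.1 e.1.2; have h2 := cabsD e.2.1 e.2.2.
apply: le_trans (cabsD _ _) _.
have := cabsD (2^-1 * (e.1.1 + e.1.2)) (2^-1 * (e.2.1 + e.2.2)).
rewrite !cabsM !cabsV !cabs_nat.
have := cabs_ge0 (e.1.1 + e.1.2); have := cabs_ge0 (e.2.1 + e.2.2).
nra.
Unshelve. all: end_near. Qed.

(* The discriminants only give x^2; the labelling of the roots selects the
   square root close to 1. *)
Let Oh_x2 : Oh 2 (fun t => x t ^+ 2 - 1 + 2 * kappa * t^-1).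
Proof.
have h1 := Oh_small_discr mu00 c00 H labelled_large_prod.
have h2 := Oh_large_discr mu00 c00 H labelled_large_prod.
pose A t : C := mu3 ^+ 2 / 4 * t^-1.
pose B t : C := - (mu1 ^+ 2 / (4 * mu0) * t^-1).
have OA : Oh 1 A by apply: OhMl; exact: Oh_inv.
have OB : Oh 1 B by apply: OhN; apply: OhMl; exact: Oh_inv.
have O1 : Oh 0 (fun t => 1 + A t).
  by apply: OhD; [exact: Oh_cst|exact: OhW OA].
pose B' t : C := (c t - d t) ^+ 2 * (- mu0 / 4) * t^-1.
have O2 : Oh 0 B'.
  have h : Oh 0 (fun t => B' t - (1 + B t) + (1 + B t)).
    by apply: OhD; [exact: OhW h2|apply: OhD; [exact: Oh_cst|exact: OhW OB]].
  by apply: Oh_ext h => t; rewrite subrK.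
(* With X and Y the two normalised discriminants, XY - 1 - A - B = (X - 1 - A) Y + (1 + A)(Y - 1 -
   B) + A B, and A + B = - 2 kappa / t. *)
have h := OhD (OhM h1 O2) (OhD (OhM O1 h2) (OhM OA OB)).
apply: Oh_near h; near=> t.
have t0 : t != 0 by near: t; exact: near_cinfty_neq0.
have -> : x t ^+ 2 = (a t - b t) ^+ 2 * (c t - d t) ^+ 2 * (- mu0) / 16
    by rewrite -hs /x; field.
by rewrite /A /B /B' /kappa; field; rewrite t0 mu00.
Unshelve. all: end_near. Qed.

(** x - 1 = (x^2 - 1) / (x + 1), and x + 1 stays away from 0 because x is within 1/2 of 1. *)
Let Oh_x1 : Oh 1 (fun t => x t - 1).
Proof.
have h1 : Oh 1 (fun t => x t ^+ 2 - 1).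
  have h : Oh 1 (fun t => (x t ^+ 2 - 1 + 2 * kappa * t^-1) - 2 * kappa * t^-1).
    by apply: OhB; [exact: OhW Oh_x2|apply: OhMl; exact: Oh_inv].
  by apply: Oh_ext h => t; rewrite addrK.
have h2 : \forall t \near cinfty R, 1 <= cabs (x t + 1).
  near=> t; have hx : cabs (x t - 1) <= 2^-1 by near: t; exact: x_near1.
  have := ler_cabsD 2 (x t - 1); rewrite cabs_nat.
  have -> : 2 + (x t - 1) = x t + 1 by ring.
  lra.
have h := OhM h1 (Oh_bounded_below ltr01 h2); rewrite addn0 in h.
apply: Oh_near h; near=> t.
have h3 : 1 <= cabs (x t + 1) by near: t; exact: h2.
have n0 : x t + 1 != 0 by rewrite -cabs_gt0 (lt_le_trans _ h3).
by field.
Unshelve. all: end_near. Qed.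

(** 1 / x = 1 - (x - 1) + O(t^-2), and x - 1 = ((x^2 - 1) - (x - 1)^2) / 2. *)
Let Oh_xV : Oh 2 (fun t => (x t)^-1 - 1 - kappa * t^-1).
Proof.
have h1 := Oh_inv1D Oh_x1.
have h : Oh 2 (fun t => ((1 + (x t - 1))^-1 - (1 - (x t - 1)))
    - 2^-1 * ((x t ^+ 2 - 1 + 2 * kappa * t^-1) - (x t - 1) ^+ 2)).
  apply: OhB; first exact: h1.
  apply: OhMl; apply: OhB; [exact: Oh_x2|exact: (OhX 2 Oh_x1)].
apply: Oh_ext h => t.
have -> : 1 + (x t - 1) = x t by ring.
by set y := (x t)^-1; set z := t^-1; field.
Qed.

Let Oh_xV0 : Oh 0 (fun t => (x t)^-1).
Proof. by apply: Oh_ext (Oh_inv1D0 Oh_x1) => t; rewrite addrCA subrr addr0. Qed.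

Let near_x0 : \forall t \near cinfty R, x t != 0.
Proof.
near=> t; have hx : cabs (x t - 1) <= 2^-1 by near: t; exact: x_near1.
rewrite -cabs_gt0; have := ler_cabsD 1 (x t - 1); rewrite cabs1.
rewrite addrCA subrr addr0; lra.
Unshelve. all: end_near. Qed.

(** The relation with t turns (c - b)(a - d) into N / 2 - (3/2 (ab + cd) - t / (2 mu0)), where N =
    (a - b)(c - d) = 4 x / s. Then cd = t / mu0 + O(t^-1), ab = O(t^-1) and mu0 = - s^2 give the two
    terms. *)
Let Oh_w : Oh 2 (fun t => w t - (2^-1 * t^-1 + (4 * s)^-1 * (x t)^-1)).
Proof.
have h1 := Oh_large_prod mu00 c00 H labelled_large_prod.
have h2 := Oh_small_prod mu00 c00 H labelled_large_prod.
have h : Oh 2 (fun t => - (s / 4 * (3 / 2) * (((c t * d t / t - mu0^-1) +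
    t^-1 ^+ 2 * (a t * b t * t)) * (x t)^-1))).
  apply: OhN; apply: OhMl; apply: (@OhM _ 2 0); last exact: Oh_xV0.
  apply: OhD h1 _; exact: (OhM (OhX 2 (@Oh_inv R)) h2).
apply: Oh_near h; near=> t.
have t0 : t != 0 by near: t; exact: near_cinfty_neq0.
have xn0 : x t != 0 by near: t; exact: near_x0.
have [_ v2 _ _] : [/\ mu0 * ((a t + b t) + (c t + d t)) = - mu1,
      mu0 * (a t * b t + c t * d t + (a t + b t) * (c t + d t)) = t,
      mu0 * ((a t + b t) * (c t * d t) + (c t + d t) * (a t * b t)) = - mu3 &
      mu0 * ((a t * b t) * (c t * d t)) = - 1].
  by apply: nut_vieta; near: t; exact: H.
have D_E : (c t - b t) * (a t - d t) =
    (a t - b t) * (c t - d t) / 2 - (3 / 2 * (a t * b t + c t * d t) - t / (2 * mu0)).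
  by rewrite -[X in X / (2 * mu0)]v2; field.
have N0 : (a t - b t) * (c t - d t) != 0.
  by apply: contraNneq xn0; rewrite /x => ->; rewrite !mul0r.
have NE : (a t - b t) * (c t - d t) = 4 * x t / s by rewrite /x; field.
have s2 : mu0 = - s ^+ 2 by rewrite hs opprK.
rewrite /w D_E NE s2; field.
by rewrite t0 xn0 s0.
Unshelve. all: end_near. Qed.

Let Oh_w1 : Oh 1 (fun t => 4 * s * w t - 1).
Proof.
have h : Oh 1 (fun t => 4 * s * (w t - (2^-1 * t^-1 + (4 * s)^-1 * (x t)^-1)) + 2 * s * t^-1
   + (((x t)^-1 - 1 - kappa * t^-1) + kappa * t^-1)).
  apply: OhD; apply: OhD.
  - by apply: OhMl; exact: OhW Oh_w.
  - by apply: OhMl; exact: Oh_inv.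
  - exact: OhW Oh_xV.
  - by apply: OhMl; exact: Oh_inv.
apply: Oh_ext h => t; set y := (x t)^-1; set z := t^-1; by field.
Qed.

Let Oh_w0 : Oh 0 w.
Proof.
have h : Oh 0 (fun t => (4 * s)^-1 * ((4 * s * w t - 1) + 1)).
  by apply: OhMl; apply: OhD; [exact: OhW Oh_w1|exact: Oh_cst].
by apply: Oh_ext h => t; field.
Qed.

Let Oh_wV : Oh 0 (fun t => (w t)^-1).
Proof.
have h := OhMl (4 * s) (Oh_inv1D0 Oh_w1).
apply: Oh_ext h => t; rewrite addrCA subrr addr0 invfM mulrA divff ?mul1r //.
by rewrite mulf_neq0.
Qed.

Let near_w0 : \forall t \near cinfty R, w t != 0.
Proof.
have e2 : 0 < 2^-1 :> R by rewrite invr_gt0.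
have h1 := Oh_small Oh_w1 e2.
near=> t; have h2 : cabs (4 * s * w t - 1) <= 2^-1 by near: t; exact: h1.
apply: contraPneq h2 => ->; rewrite mulr0 sub0r cabsN cabs1; lra.
Unshelve. all: end_near. Qed.

Variable tau : C -> C.
Hypothesis hmod : fibre_modulus mu0 mu1 mu3 s a b c d tau.
Let q t := nome (tau t).

Let near_q (e : R) : 0 < e -> \forall t \near cinfty R, cabs (q t) <= e.
Proof.
move=> e0; have [_ /cvgryPge h] := hmod.
near=> t; rewrite /q cabs_nome.
have : - ln e / pi <= complex.Im (tau t) by near: t; exact: h.
rewrite ler_pdivrMr ?pi_gt0 // => h'.
rewrite -[leRHS]lnK ?posrE // ler_expR; lra.
Unshelve. all: end_near. Qed.

(** * Inversion of lambda near the cusp *)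

Section ThetaRatio.
Variables r2 r3 : C -> C.
Let u t := theta_ratio (tau t) (r2 t) (r3 t).
Hypothesis hr2 : \forall t \near cinfty R, cabs (r2 t) <= 8 * cabs (q t) ^+ 2.
Hypothesis hr3 : \forall t \near cinfty R, cabs (r3 t) <= 8 * cabs (q t) ^+ 2.
Hypothesis hl : \forall t \near cinfty R, modular_lambda (tau t) = 16 * q t * u t.

(** lambda(tau) is the cross-ratio, which is unchanged under z |-> - z and equals 1 / (t w). *)
Let near_eq : \forall t \near cinfty R, 16 * q t * u t * (t * w t) = 1.
Proof.
have [hm _] := hmod.
near=> t.
have t0 : t != 0 by near: t; exact: near_cinfty_neq0.
have wn0 : w t != 0 by near: t; exact: near_w0.
have [_ _ _ lE] : is_modulus (hitchin_fibre mu0 mu1 mu3 s t) (- a t) (- b t) (- c t) (- d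
    t) (tau t).
  by near: t.
have <- : modular_lambda (tau t) = 16 * q t * u t by near: t.
rewrite lE; have -> : cross_ratio (- a t) (- b t) (- c t) (- d t) = (t * w t)^-1.
  rewrite /w /cross_ratio !mulrA mulfV // mul1r invf_div; congr (_ / _); ring.
by rewrite mulVf // mulf_neq0.
Unshelve. all: end_near. Qed.

Let near_small : \forall t \near cinfty R,
  [/\ cabs (q t) <= 16^-1, cabs (r2 t) <= 2^-1 & cabs (r3 t) <= 2^-1].
Proof.
have e0 : 0 < 16^-1 :> R by rewrite invr_gt0.
near=> t.
have h : cabs (q t) <= 16^-1 by near: t; exact: near_q.
have h0 := cabs_ge0 (q t).
have h2 : cabs (r2 t) <= 8 * cabs (q t) ^+ 2 by near: t; exact: hr2.
have h3 : cabs (r3 t) <= 8 * cabs (q t) ^+ 2 by near: t; exact: hr3.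
by split => //; nra.
Unshelve. all: end_near. Qed.

Let near_u : \forall t \near cinfty R, 4^-1 ^+ 4 <= cabs (u t).
Proof.
near=> t.
have [h1 h2 h3] : [/\ cabs (q t) <= 16^-1, cabs (r2 t) <= 2^-1 & cabs (r3 t) <= 2^-1].
  by near: t; exact: near_small.
rewrite /u /theta_ratio cabsX lerXn2r ?nnegrE ?invr_ge0 ?cabs_ge0 //.
rewrite cabsM cabsV.
have k1 : 2^-1 <= cabs (1 + r2 t) by have := ler_cabsD 1 (r2 t); rewrite cabs1; lra.
have k2 : cabs (1 + (2 * q t + r3 t)) <= 2.
  have := cabsD 1 (2 * q t + r3 t); have := cabsD (2 * q t) (r3 t).
  rewrite cabsM cabs_nat cabs1; lra.
have k3 : 0 < cabs (1 + (2 * q t + r3 t)).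
  have := ler_cabsD 1 (2 * q t + r3 t); have := cabsD (2 * q t) (r3 t).
  rewrite cabsM cabs_nat cabs1; lra.
rewrite ler_pdivlMr //; lra.
Unshelve. all: end_near. Qed.

Let Oh_uV : Oh 0 (fun t => (u t)^-1).
Proof. by apply: Oh_bounded_below near_u; rewrite exprn_gt0 // invr_gt0. Qed.

Let near_u0 : \forall t \near cinfty R, u t != 0.
Proof.
near=> t; rewrite -cabs_gt0; apply: (@lt_le_trans _ _ (4^-1 ^+ 4)).
  by rewrite exprn_gt0 // invr_gt0.
by near: t; exact: near_u.
Unshelve. all: end_near. Qed.

(** [near_eq] solves to q = (16 u t w)^-1, and crude lower bounds on u and w already give the order
    t^-1. This in turn makes [r2] and [r3] of order t^-2. *)
Let Oh_q : Oh 1 q.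
Proof.
have h := OhMl (16^-1) (OhM Oh_uV (OhM (@Oh_inv R) Oh_wV)).
apply: Oh_near h; near=> t.
have t0 : t != 0 by near: t; exact: near_cinfty_neq0.
have wn0 : w t != 0 by near: t; exact: near_w0.
have un0 : u t != 0 by near: t; exact: near_u0.
have E : 16 * q t * u t * (t * w t) = 1 by near: t; exact: near_eq.
apply: (mulIf (mulf_neq0 (mulf_neq0 t0 wn0) un0)).
apply: (mulfI (_ : 16 != 0)); first by rewrite pnatr_eq0.
rewrite [RHS](_ : _ = 16 * q t * u t * (t * w t)); last by ring.
by rewrite E; field; rewrite t0 wn0 un0.
Unshelve. all: end_near. Qed.

Let Oh_q2 (r : C -> C) : (\forall t \near cinfty R, cabs (r t) <=
    8 * cabs (q t) ^+ 2) -> Oh 2 r.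
Proof.
move=> hr; have [K K0 HK] := Oh_ge0 Oh_q.
exists (8 * K ^+ 2); near=> t.
have h : cabs (r t) <= 8 * cabs (q t) ^+ 2 by near: t; exact: hr.
apply: le_trans h _; rewrite -mulrA ler_pM2l //.
have -> : K ^+ 2 * cabs t ^- 2 = (K * cabs t ^- 1) ^+ 2 by rewrite exprMn exprVn.
by rewrite lerXn2r ?nnegrE ?cabs_ge0 //; near: t; [near=> t;
    exact: le_trans (cabs_ge0 _) (near HK t _)|exact: HK].
Unshelve. all: end_near. Qed.

Let Oh_u1 : Oh 2 (fun t => u t - (1 - 8 * q t)).
Proof.
have O2 := Oh_q2 hr2; have O3 := Oh_q2 hr3.
pose g t := 2 * q t + r3 t.
have Og : Oh 1 g by apply: OhD; [apply: OhMl; exact: Oh_q|exact: OhW O3].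
(* [h] gathers the terms of second order in (1 + r2) / (1 + g) = 1 - 2 q + h. *)
pose h t := (1 + g t)^-1 - (1 - g t) - r3 t + r2 t * (1 + g t)^-1.
have Oh2 : Oh 2 h.
  apply: OhD; last exact: (OhM O2 (Oh_inv1D0 Og)).
  apply: OhB => //; exact: (Oh_inv1D Og).
pose k t := - (2 * q t) + h t.
have Ok : Oh 1 k.
  apply: OhD; last exact: OhW Oh2.
  by apply: OhN; apply: OhMl; exact: Oh_q.
(* (1 + k)^4 = 1 + 4 k + k^2 (6 + 4 k + k^2), with 4 k = - 8 q + 4 h. *)
have hh : Oh 2 (fun t => 4 * h t + k t ^+ 2 * (6 + 4 * k t + k t ^+ 2)).
  apply: OhD; first exact: OhMl.
  apply: (@OhM _ 2 0); first exact: (OhX 2 Ok).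
  apply: OhD; last by apply: (@OhW _ _ 2) => //; exact: (OhX 2 Ok).
  apply: OhD; first exact: Oh_cst.
  by apply: OhMl; exact: OhW Ok.
apply: Oh_ext hh => t.
rewrite /u /theta_ratio -/(q t) -/(g t).
have -> : (1 + r2 t) / (1 + g t) = 1 + k t by rewrite /k /h /g; ring.
by rewrite /k; ring.
Qed.

(* The term 2^-1 / t of w cancels against the second coefficient of
   u = 1 - 8 q + O(q^2). *)
Lemma Oh_nome_inv : Oh 2 (fun t => s / 4 * (t * q t)^-1 - 1 - kappa * t^-1).
Proof.
have Ou1 : Oh 1 (fun t => u t - 1).
  have h : Oh 1 (fun t => (u t - (1 - 8 * q t)) + (- (8 * q t))).
    by apply: OhD; [exact: OhW Oh_u1|apply: OhN; apply: OhMl; exact: Oh_q].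
  by apply: Oh_ext h => t; ring.
(* By [near_eq], s / (4 t q) = 4 s u w and 8 q w = 1 / (2 t u), so these four summands add up to the
   claimed expression. *)
have h : Oh 2 (fun t => 4 * s * (w t * (u t - (1 - 8 * q t)))
   + 4 * s * (w t - (2^-1 * t^-1 + (4 * s)^-1 * (x t)^-1))
   + (2 * s) * (t^-1 * ((u t - 1) * (u t)^-1))
   + ((x t)^-1 - 1 - kappa * t^-1)).
  apply: OhD; last exact: Oh_xV.
  apply: OhD; last by apply: OhMl; exact: (OhM (@Oh_inv R) (OhM Ou1 Oh_uV)).
  apply: OhD; last by apply: OhMl; exact: Oh_w.
  by apply: OhMl; exact: (OhM Oh_w0 Oh_u1).
apply: Oh_near h; near=> t.
have t0 : t != 0 by near: t; exact: near_cinfty_neq0.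
have wn0 : w t != 0 by near: t; exact: near_w0.
have un0 : u t != 0 by near: t; exact: near_u0.
have E : 16 * q t * u t * (t * w t) = 1 by near: t; exact: near_eq.
have -> : (t * q t)^-1 = 16 * u t * w t.
  have tq0 := mulf_neq0 t0 (cexp_neq0 _ : q t != 0).
  by apply: (mulfI tq0); rewrite mulfV // -[LHS]E; ring.
have qE : q t = (16 * u t * (t * w t))^-1.
  have n0 : 16 * u t * (t * w t) != 0.
    by apply: mulf_neq0; apply: mulf_neq0; rewrite ?pnatr_eq0.
  by apply: (mulfI n0); rewrite mulfV // -[RHS]E; ring.
rewrite qE; set y := (x t)^-1; field.
by rewrite t0 wn0 un0 s0.
Unshelve. all: end_near. Qed.

End ThetaRatio.

(** The given tau fixes the branch: as 1 / q = (4 t / s)(1 + W), subtracting the small logarithm of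
    1 + W from - i pi tau leaves a logarithm of 4 t / s. *)
Lemma fibre_modulus_asymptotics :
  exists K : R, \forall t \near cinfty R, exists L : C,
    cexp L = 4 * s^-1 * t /\
    cabs (tau t - ('i%C / pi%:C * L
             + 'i%C / pi%:C * ((mu1 ^+ 2 - mu0 * mu3 ^+ 2) / (8 * mu0)) * t^-1))
         <= K * cabs t ^- 2.
Proof.
(* The theta errors become functions of t; where |q| > 1/2 their values are arbitrary. *)
have /choice[r hr] t : exists r : C * C, cabs (q t) <= 2^-1 ->
    [/\ cabs r.1 <= 8 * cabs (q t) ^+ 2, cabs r.2 <= 8 * cabs (q t) ^+ 2 &
     modular_lambda (tau t) = 16 * q t * theta_ratio (tau t) r.1 r.2].
  have [h|h] := leP (cabs (q t)) 2^-1; last by exists (0, 0).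
  by have [r hr] := modular_lambda_expansion h; exists r.
have e2 : 0 < 2^-1 :> R by rewrite invr_gt0.
have hq := near_q e2.
have OW : Oh 2 (fun t => s / 4 * (t * q t)^-1 - 1 - kappa * t^-1).
  apply: (@Oh_nome_inv (fun t => (r t).1) (fun t => (r t).2)).
  - by apply: filterS hq => t /hr[].
  - by apply: filterS hq => t /hr[].
  - by apply: filterS hq => t /hr[].
pose W t := s / 4 * (t * q t)^-1 - 1.
have OW1 : Oh 1 W.
  have h : Oh 1 (fun t => (W t - kappa * t^-1) + kappa * t^-1).
    by apply: OhD; [exact: OhW OW|apply: OhMl; exact: Oh_inv].
  by apply: Oh_ext h => t; rewrite subrK.
have e4 : 0 < 4^-1 :> R by rewrite invr_gt0.
have W4 := Oh_small OW1 e4.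
have [K1 HK1] := OhX 2 OW1; have [K2 HK2] := OW.
exists (5 * K1 + K2); near=> t.
have t0 : t != 0 by near: t; exact: near_cinfty_neq0.
have [l lE lW] : exists2 l : C, cexp l = 1 + W t & cabs (l - W t) <= 5 * cabs (W t) ^+ 2.
  by apply: clog1D; near: t; exact: W4.
have q0 : q t != 0 by exact: cexp_neq0.
exists (- ('i%C * pi%:C * tau t) - l); split.
  rewrite cexpD !cexpN lE -/(nome (tau t)) -/(q t).
  have W0 : 1 + W t != 0 by rewrite -lE cexp_neq0.
  have -> : 4 * s^-1 * t = (q t)^-1 / (1 + W t).
    apply: (mulIf W0); rewrite mulfVK // /W; field.
    by rewrite t0 q0 s0.
  by [].
have pi0 : (pi%:C : C) != 0 by rewrite eq_complex /= eqxx andbT gt_eqF // pi_gt0.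
have i2 : ('i%C : C) ^+ 2 = -1 by exact: sqr_i.
have -> : tau t - ('i%C / pi%:C * (- ('i%C * pi%:C * tau t) - l)
     + 'i%C / pi%:C * ((mu1 ^+ 2 - mu0 * mu3 ^+ 2) / (8 * mu0)) * t^-1)
   = 'i%C / pi%:C * ((l - W t) + (W t - kappa * t^-1)).
  have tauE : tau t = - ('i%C ^+ 2 * tau t) by rewrite i2 mulN1r opprK.
  rewrite {1}tauE.
  move: pi0; rewrite /kappa; set k := _ / (8 * mu0); move: (pi%:C) => p pi0.
  by field; rewrite t0 pi0.
have ipi : cabs ('i%C / pi%:C : C) <= 1.
  rewrite cabsM cabsV cabs_real [cabs _]/cabs /= expr0n expr1n add0r sqrtr1 mul1r.
  have := pi_ge2 R; have := pi_gt0 R => p0 p2.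
  rewrite gtr0_norm //. by rewrite invf_le1 //; lra.
rewrite cabsM; apply: le_trans (ler_wpM2r (cabs_ge0 _) ipi) _; rewrite mul1r.
apply: le_trans (cabsD _ _) _; rewrite mulrDl -mulrA; apply: lerD.
  apply: le_trans lW _; rewrite ler_pM2l // -cabsX; near: t; exact: HK1.
near: t; exact: HK2.
Unshelve. all: end_near. Qed.

End ModulusAsymptotics.

(** * Factorisation and location of the roots *)

Lemma nut_factor (R : realType) (mu0 mu1 mu3 t : R[i]) : mu0 != 0 ->
  exists r : R[i] * R[i] * (R[i] * R[i]),
    nut mu0 mu1 mu3 t =
      mu0 *: (('X - r.1.1%:P) * ('X - r.1.2%:P) * ('X - r.2.1%:P) * ('X - r.2.2%:P)).
Proof.
move=> mu00; set p := nut _ _ _ _.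
have sp : size p = 5.
  rewrite /p /nut addrC size_polyDl.
    by rewrite size_scale // size_polyXn.
  rewrite size_scale // size_polyXn ltnS.
  apply: (leq_trans (size_polyD _ _)); rewrite geq_max; apply/andP; split; last first.
    by apply: leq_trans (size_scale_leq _ _) _; rewrite size_polyXn.
  apply: (leq_trans (size_polyD _ _)); rewrite geq_max; apply/andP; split; last first.
    by apply: leq_trans (size_scale_leq _ _) _; rewrite size_polyXn.
  apply: (leq_trans (size_polyD _ _)); rewrite geq_max; apply/andP; split; last first.
    by apply: leq_trans (size_scale_leq _ _) _; rewrite size_polyX.
  by rewrite size_polyN size_poly1.
have lp : lead_coef p = mu0.
  rewrite lead_coefE sp /p /nut !(coefD, coefZ, coefN, coefX, coefXn, coef1) /=.
  by rewrite !(mulr0, mulr1, addr0, add0r, oppr0).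
have [r pE] := closed_field_poly_normal p.
have : size r = 4%N.
  have := sp; rewrite pE lp size_scale // size_prod_XsubC => -[] //.
case: r pE => [|a [|b [|c [|d [|e r]]]]] // pE _.
exists ((a, b), (c, d)) => /=.
by rewrite pE lp !big_cons big_nil mulr1 !mulrA.
Qed.

(** Pigeonhole over the six products of two roots, hence the constant 6; the factors are reordered
    to put the pair found last. *)
Lemma nut_factor_large (R : realType) (mu0 mu1 mu3 t : R[i]) : mu0 != 0 ->
  exists r : R[i] * R[i] * (R[i] * R[i]),
    nut mu0 mu1 mu3 t =
      mu0 *: (('X - r.1.1%:P) * ('X - r.1.2%:P) * ('X - r.2.1%:P) * ('X - r.2.2%:P))
    /\ (6 * cabs mu0)^-1 * cabs t <= cabs (r.2.1 * r.2.2).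
Proof.
move=> mu00; have [[[a b] [c d]] /= E] := nut_factor mu1 mu3 t mu00.
have [_ v2 _ _] := nut_vieta E.
have m0 : 0 < cabs mu0 by rewrite cabs_gt0.
have k x : (6 * cabs mu0)^-1 * cabs t <= cabs x \/ 6 * cabs mu0 * cabs x < cabs t.
  have [h|h] := leP (cabs t) (6 * cabs mu0 * cabs x); last by right.
  by left; rewrite mulrC ler_pdivrMr ?mulr_gt0 // mulrC.
have [h|h1] := k (c * d); first by exists ((a, b), (c, d)).
have [h|h2] := k (b * d).
  by exists ((a, c), (b, d)); split => //; rewrite E /=; congr (_ *: _); ring.
have [h|h3] := k (b * c).
  by exists ((a, d), (b, c)); split => //; rewrite E /=; congr (_ *: _); ring.
have [h|h4] := k (a * d).
  by exists ((b, c), (a, d)); split => //; rewrite E /=; congr (_ *: _); ring.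
have [h|h5] := k (a * c).
  by exists ((b, d), (a, c)); split => //; rewrite E /=; congr (_ *: _); ring.
have [h|h6] := k (a * b).
  by exists ((c, d), (a, b)); split => //; rewrite E /=; congr (_ *: _); ring.
exfalso.
have : cabs t <= cabs mu0 * (cabs (a * b) + cabs (c * d) +
    (cabs (a * c) + cabs (a * d) + (cabs (b * c) + cabs (b * d)))).
  rewrite -v2 cabsM ler_wpM2l ?cabs_ge0 //.
  have -> : (a + b) * (c + d) = a * c + a * d + (b * c + b * d) by ring.
  do ![apply: le_trans (cabsD _ _) _; apply: lerD] => //; exact: cabsD.
lra.
Qed.

Section RootLocalization.
Context {R : realType}.
Local Notation C := R[i].
Variables (mu0 mu1 mu3 : C).
Hypothesis mu00 : mu0 != 0.

(* With h = |t|^(1/2), the roots a, b are of size 1/h and c, d of size h, and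
   the roots of each pair are as far apart as their size allows. *)
Definition separated_roots (B h : R) (t a b c d : C) : Prop :=
  [/\ nut mu0 mu1 mu3 t = mu0 *: (('X - a%:P) * ('X - b%:P) * ('X - c%:P) * ('X - d%:P)),
      cabs a <= 2 / h /\ cabs b <= 2 / h, h^-1 <= cabs (a - b),
      B / 4 * h <= cabs c /\ B / 4 * h <= cabs d & B * h <= cabs (c - d)].

(** The discriminants give the differences within each pair, and the sums of the pairs are of lower
    order, so half sum and half difference locate each root. *)
Lemma near_separated_roots : exists2 B : R, 0 < B &
  \forall t \near cinfty R, exists a b c d : C,
    separated_roots B (Num.sqrt (cabs t)) t a b c d.
Proof.
have m0 : 0 < cabs mu0 by rewrite cabs_gt0.
have /choice[r hr] t := nut_factor_large mu1 mu3 t mu00.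
pose a t := (r t).1.1; pose b t := (r t).1.2; pose c t := (r t).2.1; pose d t := (r t).2.2.
have c00 : 0 < (6 * cabs mu0)^-1 by rewrite invr_gt0 mulr_gt0.
have H : \forall t \near cinfty R, nut mu0 mu1 mu3 t =
  mu0 *: (('X - (a t)%:P) * ('X - (b t)%:P) * ('X - (c t)%:P) * ('X - (d t)%:P)).
  by near=> t; have [] := hr t.
have Hcd : \forall t \near cinfty R, (6 * cabs mu0)^-1 * cabs t <= cabs (c t * d t).
  by near=> t; have [] := hr t.
(* |c - d|^2 is asymptotic to 4 |t| / |mu0| = 2 B^2 h^2, and a relative error of 1/2 still leaves |c
   - d| >= B h. *)
pose B := Num.sqrt (2 / cabs mu0).
have B0 : 0 < B by rewrite sqrtr_gt0 divr_gt0.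
have B2 : B ^+ 2 = 2 / cabs mu0 by rewrite sqr_sqrtr // divr_ge0 // ltW.
exists B => //.
have e2 : 0 < 2^-1 :> R by rewrite invr_gt0.
have n1 : \forall t \near cinfty R, cabs ((a t - b t) ^+ 2 * t / 4 - 1) <= 2^-1.
  apply: (@Oh_small _ 0) => //.
  have h : Oh 1 (fun t => ((a t - b t) ^+ 2 * t / 4 - (1 + mu3 ^+ 2 / 4 * t^-1)) +
      mu3 ^+ 2 / 4 * t^-1).
    apply: OhD; first exact: OhW (Oh_small_discr mu00 c00 H Hcd).
    by apply: OhMl; exact: Oh_inv.
  by apply: Oh_ext h => t; ring.
have n2 : \forall t \near cinfty R, cabs ((c t - d t) ^+ 2 * (- mu0 / 4) * t^-1 - 1) <= 2^-1.
  apply: (@Oh_small _ 0) => //.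
  have h : Oh 1 (fun t => ((c t - d t) ^+ 2 * (- mu0 / 4) * t^-1 - (1 - mu1 ^+ 2 / (4 *
      mu0) * t^-1)) + (- (mu1 ^+ 2 / (4 * mu0) * t^-1))).
    apply: OhD; first exact: OhW (Oh_large_discr mu00 c00 H Hcd).
    by apply: OhN; apply: OhMl; exact: Oh_inv.
  by apply: Oh_ext h => t; ring.
have [K K0 n3] := Oh_ge0 (Oh_small_sum mu00 c00 H Hcd).
pose L := K + cabs (mu1 / mu0).
have L0 : 0 < L by rewrite ltr_wpDr ?cabs_ge0.
near=> t; exists (a t), (b t), (c t), (d t).
have t0 : t != 0 by near: t; exact: near_cinfty_neq0.
have r0 : 0 < cabs t by rewrite cabs_gt0.
set h := Num.sqrt (cabs t).
have h0 : 0 < h by rewrite sqrtr_gt0.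
have h2 : cabs t = h ^+ 2 by rewrite sqr_sqrtr // ltW.
have hbig (x : R) : 0 <= x -> x ^+ 2 < cabs t -> x <= h.
  by move=> x0; rewrite h2 => /ltW; rewrite ler_sqr ?nnegrE ?(ltW h0).
have h1 : 1 <= h by apply: hbig => //; near: t; exact: near_cinfty_gt.
have hK : K <= h by apply: hbig; [exact: ltW|near: t; exact: near_cinfty_gt].
have hL : L * 2 / B <= h.
  apply: hbig; first by rewrite ltW // divr_gt0 // mulr_gt0.
  by near: t; exact: near_cinfty_gt.
have Et : nut mu0 mu1 mu3 t =
  mu0 *: (('X - (a t)%:P) * ('X - (b t)%:P) * ('X - (c t)%:P) * ('X - (d t)%:P))
      by near: t; exact: H.
have s1 : cabs (a t + b t) <= K / h ^+ 2.
  rewrite ler_pdivlMr ?exprn_gt0 // -h2 -cabsM.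
  have : cabs ((a t + b t) * t) <= K * cabs t ^- 0 by near: t; exact: n3.
  by rewrite expr0 invr1 mulr1.
have s1' : cabs (a t + b t) <= h^-1.
  by apply: le_trans s1 _; rewrite ler_pdivrMr ?exprn_gt0 // expr2 mulKf // gt_eqF.
have ab : 2^-1 <= cabs (a t - b t) ^+ 2 * h ^+ 2 / 4 <= 2.
  have : cabs ((a t - b t) ^+ 2 * t / 4 - 1) <= 2^-1 by near: t; exact: n1.
  have u1 := ler_cabsB 1 ((a t - b t) ^+ 2 * t / 4).
  have u2 := ler_cabsB ((a t - b t) ^+ 2 * t / 4) 1.
  rewrite cabsBC in u1.
  have uE : cabs ((a t - b t) ^+ 2 * t / 4) = cabs (a t - b t) ^+ 2 * h ^+ 2 / 4.
    by rewrite (expr2 (_ - _)) !cabsM !cabsV cabs_nat h2; field.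
  rewrite uE cabs1 in u1 u2; lra.
have cd : 2^-1 <= cabs (c t - d t) ^+ 2 / (2 * B ^+ 2 * h ^+ 2).
  have : cabs ((c t - d t) ^+ 2 * (- mu0 / 4) * t^-1 - 1) <= 2^-1 by near: t; exact: n2.
  have u1 := ler_cabsB 1 ((c t - d t) ^+ 2 * (- mu0 / 4) * t^-1).
  rewrite cabsBC in u1.
  have uE : cabs ((c t - d t) ^+ 2 * (- mu0 / 4) * t^-1) =
      cabs (c t - d t) ^+ 2 / (2 * B ^+ 2 * h ^+ 2).
    rewrite (expr2 (_ - _)) !cabsM !cabsV cabs_nat cabsN h2 B2; field.
    by rewrite gt_eqF // gt_eqF.
  rewrite uE cabs1 in u1; lra.
have hab : h^-1 <= cabs (a t - b t).
  rewrite -ler_sqr ?nnegrE ?invr_ge0 ?(ltW h0) ?cabs_ge0 // exprVn.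
  by rewrite -[leLHS]mul1r ler_pdivrMr ?exprn_gt0 //; lra.
have hab' : cabs (a t - b t) <= 3 / h.
  rewrite -ler_sqr ?nnegrE ?cabs_ge0 ?divr_ge0 ?(ltW h0) // expr_div_n.
  by rewrite ler_pdivlMr ?exprn_gt0 //; lra.
have hcd : B * h <= cabs (c t - d t).
  rewrite -ler_sqr ?nnegrE ?cabs_ge0 ?mulr_ge0 ?(ltW h0) ?(ltW B0) // exprMn.
  by move: cd; rewrite ler_pdivlMr ?mulr_gt0 ?exprn_gt0 //; lra.
have s2 : cabs (c t + d t) <= B / 2 * h.
  have [v1 _ _ _] := nut_vieta Et.
  have -> : c t + d t = - (mu1 / mu0) - (a t + b t).
    apply: (mulfI mu00); rewrite mulrBr mulrN mulrCA divff // mulr1 -v1; ring.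
  apply: le_trans (cabsB _ _) _; rewrite cabsN.
  have : L <= B / 2 * h.
    by move: hL; rewrite ler_pdivrMr //; lra.
  have : K / h ^+ 2 <= K.
    rewrite ler_pdivrMr ?exprn_gt0 // ler_peMr ?(ltW K0) //.
    by rewrite exprn_ege1.
  rewrite /L; lra.
have hd (z w : C) : 2 * z = (z + w) + (z - w) /\ 2 * w = (z + w) - (z - w) by split; ring.
have hi : h^-1 = 1 / h by rewrite mul1r.
split=> //.
- have [ha hb] := hd (a t) (b t); split.
    have : cabs (2 * a t) <= cabs (a t + b t) + cabs (a t - b t) by rewrite ha; exact: cabsD.
    rewrite cabsM cabs_nat; lra.
  have : cabs (2 * b t) <= cabs (a t + b t) + cabs (a t - b t) by rewrite hb; exact: cabsB.
  rewrite cabsM cabs_nat; lra.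
- have [hc hdd] := hd (c t) (d t); split.
    have : cabs (c t - d t) - cabs (c t + d t) <= cabs (2 * c t)
        by rewrite hc (addrC (c t + d t)); exact: ler_cabsD.
    rewrite cabsM cabs_nat; lra.
  have : cabs (c t - d t) - cabs (c t + d t) <= cabs (2 * d t)
      by rewrite hdd (cabsBC (c t + d t)); exact: ler_cabsB.
  rewrite cabsM cabs_nat; lra.
Unshelve. all: end_near. Qed.

End RootLocalization.

(** * The metric *)

Section PointwiseBounds.
Context {R : realType}.
Local Notation C := R[i].

(* Also valid at z = c and z = d, where the left-hand side is 0^-1 = 0. *)
Lemma inv_cabs_mul_le (z c d : C) : c != d ->
  (cabs (z - c) * cabs (z - d))^-1 <=
  (cabs (c - d))^-1 * ((cabs (z - c))^-1 + (cabs (z - d))^-1).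
Proof.
move=> cd.
have D0 : 0 < cabs (c - d) by rewrite cabs_gt0 subr_eq0.
have r0 : 0 <= (cabs (c - d))^-1 * ((cabs (z - c))^-1 + (cabs (z - d))^-1).
  by rewrite mulr_ge0 ?addr_ge0 ?invr_ge0 ?cabs_ge0.
have [->|zc] := eqVneq (cabs (z - c)) 0; first
    by rewrite mul0r !invr0 mulr_ge0 ?addr_ge0 ?invr_ge0 ?cabs_ge0.
have [->|zd] := eqVneq (cabs (z - d)) 0; first
    by rewrite mulr0 !invr0 mulr_ge0 ?addr_ge0 ?invr_ge0 ?cabs_ge0.
have x0 : 0 < cabs (z - c) by rewrite lt_def zc cabs_ge0.
have y0 : 0 < cabs (z - d) by rewrite lt_def zd cabs_ge0.
have : cabs (c - d) <= cabs (z - c) + cabs (z - d).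
  have -> : c - d = (z - d) - (z - c) by ring.
  by rewrite (addrC (cabs _)); exact: cabsB.
move: (cabs (c - d)) (cabs (z - c)) (cabs (z - d)) D0 x0 y0 => D x y D0 x0 y0 h.
rewrite -subr_ge0.
have -> : D^-1 * (x^-1 + y^-1) - (x * y)^-1 = (x + y - D) / (D * (x * y)).
  by field; rewrite !gt_eqF.
by rewrite divr_ge0 ?subr_ge0 // ?mulr_ge0 // ltW.
Qed.

(** Inside the disc of radius r about c, |z|^-2 <= r^-2; outside it, the inverse cube of the smaller
    of |z| and |z - c| bounds the product. *)
Lemma inv_sqr_mul_le (z c : C) (r : R) : 0 < r -> r <= cabs z ->
  cabs z ^- 2 * (cabs (z - c))^-1 <=
  kernel3 r (cabs z) + kernel3 r (cabs (z - c)) + r ^- 2 * kernel1 r (cabs (z - c)).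
Proof.
rewrite /kernel3 /kernel1 => r0 rz; rewrite rz.
have z0 : 0 < cabs z by exact: lt_le_trans rz.
have [rc|cr] := leP r (cabs (z - c)); last first.
  rewrite addr0.
  have h : cabs z ^- 2 * (cabs (z - c))^-1 <= r ^- 2 * (cabs (z - c))^-1.
    rewrite ler_wpM2r ?invr_ge0 ?cabs_ge0 // lef_pV2 ?posrE ?exprn_gt0 //.
    by rewrite ler_sqr ?nnegrE ?(ltW r0) ?(ltW z0).
  by apply: le_trans h _; rewrite lerDr invr_ge0 exprn_ge0 // ltW.
rewrite mulr0 addr0.
have c0 : 0 < cabs (z - c) by exact: lt_le_trans rc.
move: (cabs z) (cabs (z - c)) z0 c0 => x y x0 y0.
have p3 (u : R) : 0 < u -> 0 <= u ^- 3 by move=> u0; rewrite invr_ge0 exprn_ge0 // ltW.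
have [xy|yx] := leP x y.
  apply: (@le_trans _ _ (x ^- 3)); last by rewrite lerDl p3.
  by rewrite -invfM lef_pV2 ?posrE ?mulr_gt0 ?exprn_gt0 // exprSr ler_wpM2l // exprn_ge0 // ltW.
apply: (@le_trans _ _ (y ^- 3)); last by rewrite lerDr p3.
rewrite -invfM lef_pV2 ?posrE ?mulr_gt0 ?exprn_gt0 // exprSr ler_wpM2r //; first exact: ltW.
by rewrite ler_sqr ?nnegrE ?(ltW x0) ?(ltW y0) ?(ltW yx).
Qed.

Variables (mu0 mu1 mu3 : C).

(** [K] bounds the terms of [nut] other than t z^2 by K (1 + |z|^4); M = 4 K makes this at most half
    of |t| |z|^2 on the annulus. *)
Definition nut_const : R := 1 + cabs mu0 + cabs mu1 + cabs mu3.
Local Notation K := nut_const.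
Local Notation M := (4 * K).

Lemma nut_const_ge1 : 1 <= K.
Proof. by rewrite /K -!addrA lerDl !addr_ge0 ?cabs_ge0. Qed.

Lemma cabs_nut_sub (t z : C) :
  `|cabs (nut mu0 mu1 mu3 t).[z] - cabs t * cabs z ^+ 2| <= K * (1 + cabs z ^+ 4).
Proof.
have nE : (nut mu0 mu1 mu3 t).[z] =
    t * z ^+ 2 + (- 1 + (mu3 * z + (mu1 * z ^+ 3 + mu0 * z ^+ 4))).
  by rewrite /nut !hornerE /=; ring.
set P := - 1 + _ in nE.
have hP : cabs P <= K * (1 + cabs z ^+ 4).
  have h : cabs P <= 1 + (cabs mu3 * cabs z + (cabs mu1 * cabs z ^+ 3 +
      cabs mu0 * cabs z ^+ 4)).
    rewrite /P; apply: le_trans (cabsD _ _) _; rewrite cabsN cabs1 lerD2l.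
    apply: le_trans (cabsD _ _) _; rewrite cabsM lerD2l.
    by apply: le_trans (cabsD _ _) _; rewrite (cabsM mu1) (cabsM mu0) !cabsX.
  apply: le_trans h _; have := cabs_ge0 z; move: (cabs z) => X X0.
  have X1 : X <= 1 + X ^+ 4.
    have [h|h] := leP X 1; first by apply: le_trans h _; rewrite lerDl exprn_ge0.
    by rewrite ler_wpDl // ler_eXnr // ltW.
  have X3 : X ^+ 3 <= 1 + X ^+ 4.
    have [h|h] := leP X 1; first
        by apply: le_trans (exprn_ile1 _ X0 h) _; rewrite lerDl exprn_ge0.
    by rewrite ler_wpDl // ler_weXn2l // ltW.
  have X4 : 0 <= X ^+ 4 by rewrite exprn_ge0.
  have h1 := ler_wpM2l (cabs_ge0 mu3) X1; have h2 := ler_wpM2l (cabs_ge0 mu1) X3.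
  have h3 := cabs_ge0 mu0; rewrite /K; lra.
apply: le_trans hP.
have tz : cabs t * cabs z ^+ 2 = cabs (t * z ^+ 2) by rewrite cabsM cabsX.
rewrite tz nE ler_norml; apply/andP; split.
  have := ler_cabsD (t * z ^+ 2) P; lra.
have := cabsD (t * z ^+ 2) P; lra.
Qed.

(** 2 K h^-4 (|z|^-4 + 1) after using h |z| >= M on the first term and h >= M |z| on the second. The
    radius is doubled because the disc of [kernel1] is open. *)
Definition error_kernel (h : R) (z : C) : R :=
  2 * K / (M * h ^+ 3) * (kernel3 (M / h) (cabs z) + kernel1 (2 * (h / M)) (cabs z)).

(** With N the modulus of [nut] at z and S = h^2 |z|^2, |N - S| <= S / 2, so |1 / N - 1 / S| <= 2 K
    (1 + |z|^4) / S^2. *)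
Lemma annulus_bound (t z : C) (h : R) : 0 < h -> cabs t = h ^+ 2 ->
  M / h <= cabs z <= h / M ->
  `|(cabs (nut mu0 mu1 mu3 t).[z])^-1 - h ^- 2 * cabs z ^- 2| <= error_kernel h z.
Proof.
move=> h0 th /andP[zl zr].
have K1 := nut_const_ge1; have M0 : 0 < M by lra.
have z0 : 0 < cabs z by apply: lt_le_trans zl; rewrite divr_gt0.
have := cabs_nut_sub t z; rewrite th.
rewrite /error_kernel /kernel3 /kernel1 zl ifT; last first.
  by apply: le_lt_trans zr _; rewrite -[ltLHS]mul1r ltr_pM2r ?divr_gt0 // ltr1n.
move: zl zr; rewrite ler_pdivrMr // ler_pdivlMr //.
move: (cabs z) (cabs _.[z]) z0 => X N X0 zl zr.
have zl' : 4 * K <= (X * h) ^+ 2.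
  have Xh : 0 <= X * h by rewrite mulr_ge0 ?ltW.
  have : (4 * K) ^+ 2 <= (X * h) ^+ 2 by rewrite ler_sqr ?nnegrE // ltW.
  have : 4 * K <= (4 * K) ^+ 2 by rewrite ler_eXnr //; lra.
  lra.
have zr' : 4 * K * X ^+ 2 <= h ^+ 2.
  have XM : 0 <= X * (4 * K) by rewrite mulr_ge0 ?ltW.
  have : (X * (4 * K)) ^+ 2 <= h ^+ 2 by rewrite ler_sqr ?nnegrE // ltW.
  have : 4 * K <= (4 * K) ^+ 2 by rewrite ler_eXnr //; lra.
  have := sqr_ge0 X; rewrite exprMn; nra.
rewrite exprMn in zl'.
set S := h ^+ 2 * X ^+ 2.
have S0 : 0 < S by rewrite mulr_gt0 // exprn_gt0.
have hX : K * (1 + X ^+ 4) <= S / 2.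
  have : K * X ^+ 4 <= S / 4.
    have -> : X ^+ 4 = X ^+ 2 * X ^+ 2 by ring.
    have := ler_wpM2r (sqr_ge0 X) zr'; rewrite /S; lra.
  rewrite /S in S0 *; lra.
move=> hN.
have N1 : S / 2 <= N by move: (le_trans hN hX); rewrite ler_norml => /andP[]; lra.
have N0 : 0 < N by lra.
have -> : N^-1 - h ^- 2 * X ^- 2 = (S - N) / (N * S).
  by rewrite /S; field; rewrite !gt_eqF.
rewrite normrM normfV (ger0_norm (_ : 0 <= N * S)); last by rewrite mulr_ge0 // ltW.
apply: (@le_trans _ _ (K * (1 + X ^+ 4) / (S / 2 * S))).
  apply: ler_pM => //.
  - by rewrite invr_ge0 mulr_ge0 // ltW.
  - by rewrite distrC.
  - by rewrite lef_pV2 ?posrE ?ler_pM2r ?mulr_gt0 //; lra.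
rewrite -subr_ge0.
have -> : 2 * K / (4 * K * h ^+ 3) * (X ^- 3 + X^-1) - K * (1 + X ^+ 4) / (S / 2 * S)
  = (h * X - 4 * K + X ^+ 3 * (h - 4 * K * X)) * 2 / (4 * h ^+ 4 * X ^+ 4).
  rewrite /S; field.
  by rewrite !gt_eqF //; lra.
apply: divr_ge0; last by rewrite !mulr_ge0 ?exprn_ge0 ?(ltW h0) ?(ltW X0).
apply: mulr_ge0 => //.
have : 0 <= X ^+ 3 * (h - 4 * K * X) by rewrite mulr_ge0 ?exprn_ge0 ?(ltW X0) //; lra.
lra.
Qed.

Lemma nut_product (t a b c d z : C) :
  nut mu0 mu1 mu3 t = mu0 *: (('X - a%:P) * ('X - b%:P) * ('X - c%:P) * ('X - d%:P)) ->
  cabs (nut mu0 mu1 mu3 t).[z] =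
  cabs mu0 * (cabs (z - a) * cabs (z - b)) * (cabs (z - c) * cabs (z - d)).
Proof. by move=> ->; rewrite hornerZ !hornerM !hornerXsubC !cabsM; ring. Qed.

Hypothesis mu00 : mu0 != 0.

(** 64 comes from |z - c|, |z - d| >= B h / 8, and |a - b| >= 1 / h contributes a factor h. The
    radius (M + 2) / h covers |z| < M / h seen from a root of modulus at most 2 / h. *)
Definition inner_kernel (B h : R) (a b z : C) : R :=
  64 / (cabs mu0 * B ^+ 2 * h) *
  (kernel1 ((M + 2) / h) (cabs (z - a)) + kernel1 ((M + 2) / h) (cabs (z - b))).

Lemma inner_bound (B h : R) (t a b c d z : C) : 0 < B -> 0 < h ->
  8 * M / B <= h ^+ 2 ->
  separated_roots mu0 mu1 mu3 B h t a b c d -> cabs z < M / h ->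
  (cabs (nut mu0 mu1 mu3 t).[z])^-1 <= inner_kernel B h a b z.
Proof.
move=> B0 h0 hB [E [ha hb] hab [hc hd] _] zl.
have K1 := nut_const_ge1; have M0 : 0 < M by lra.
have m0 : 0 < cabs mu0 by rewrite cabs_gt0.
have hMB : M / h <= B / 8 * h.
  by rewrite ler_pdivrMr //; move: hB; rewrite ler_pdivrMr // expr2; lra.
have zc : B / 8 * h <= cabs (z - c).
  by have := ler_cabsB c z; rewrite cabsBC; lra.
have zd : B / 8 * h <= cabs (z - d).
  by have := ler_cabsB d z; rewrite cabsBC; lra.
have za : cabs (z - a) < (M + 2) / h.
  by have := cabsB z a; rewrite mulrDl; lra.
have zb : cabs (z - b) < (M + 2) / h.
  by have := cabsB z b; rewrite mulrDl; lra.
have ab : a != b.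
  apply: contraTneq hab => ->; rewrite subrr cabs0 -ltNge invr_gt0 //.
rewrite (nut_product _ E) /inner_kernel /kernel1 za zb.
have I1 := inv_cabs_mul_le z ab.
have I2 : (cabs (a - b))^-1 <= h.
  by rewrite -[leRHS]invrK lef_pV2 ?posrE ?invr_gt0 // (lt_le_trans _ hab) // invr_gt0.
have Q0 : 0 <= (cabs (z - a))^-1 + (cabs (z - b))^-1 by rewrite addr_ge0 ?invr_ge0 ?cabs_ge0.
have I3 : (cabs (z - a) * cabs (z - b))^-1 <= h * ((cabs (z - a))^-1 + (cabs (z - b))^-1).
  by apply: le_trans I1 _; rewrite ler_wpM2r.
have Bh : 0 < B / 8 * h by rewrite mulr_gt0 // divr_gt0.
have I4 : (cabs (z - c) * cabs (z - d))^-1 <= (B / 8 * h * (B / 8 * h))^-1.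
  rewrite lef_pV2 ?posrE ?mulr_gt0 //; last 2 first.
  - exact: lt_le_trans zc.
  - exact: lt_le_trans zd.
  by rewrite ler_pM // ltW.
rewrite !invfM -!invfM [leLHS]invfM [X in X * _]invfM.
apply: (@le_trans _ _ ((cabs mu0)^-1 * (h * ((cabs (z - a))^-1 +
    (cabs (z - b))^-1)) * (B / 8 * h * (B / 8 * h))^-1)).
  apply: ler_pM => //; rewrite ?mulr_ge0 ?invr_ge0 ?mulr_ge0 ?cabs_ge0 //.
  by rewrite ler_wpM2l // invr_ge0 cabs_ge0.
rewrite le_eqVlt; apply/orP; left; apply/eqP.
set u := (cabs (z - a))^-1; set v := (cabs (z - b))^-1.
by field; rewrite !gt_eqF.
Qed.

(** 4 comes from |z - a|, |z - b| >= |z| / 2, and 1 / (B h) from |c - d|; the two brackets are those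
    of [inv_sqr_mul_le] at c and at d. *)
Definition outer_kernel (B h : R) (c d z : C) : R :=
  4 / (cabs mu0 * B * h) *
  ((kernel3 (h / M) (cabs z) + kernel3 (h / M) (cabs (z - c))
    + (h / M) ^- 2 * kernel1 (h / M) (cabs (z - c)))
  + (kernel3 (h / M) (cabs z) + kernel3 (h / M) (cabs (z - d))
    + (h / M) ^- 2 * kernel1 (h / M) (cabs (z - d)))).

Lemma outer_bound (B h : R) (t a b c d z : C) : 0 < B -> 0 < h ->
  4 * M <= h ^+ 2 ->
  separated_roots mu0 mu1 mu3 B h t a b c d -> h / M < cabs z ->
  (cabs (nut mu0 mu1 mu3 t).[z])^-1 <= outer_kernel B h c d z.
Proof.
move=> B0 h0 hB [E [ha hb] _ _ hcd] zl.
have K1 := nut_const_ge1; have M0 : 0 < M by lra.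
have m0 : 0 < cabs mu0 by rewrite cabs_gt0.
have z0 : 0 < cabs z by apply: lt_trans zl; rewrite divr_gt0.
have h2 : 2 / h <= cabs z / 2.
  apply: (@le_trans _ _ (h / M / 2)); last by rewrite ler_pM2r ?ltW // invr_gt0.
  rewrite ler_pdivrMr // -subr_ge0.
  have -> : h / M / 2 * h - 2 = (h ^+ 2 - 4 * M) / (2 * M) by field; rewrite gt_eqF //; lra.
  by rewrite divr_ge0 ?subr_ge0 // mulr_ge0 // ltW.
have za : cabs z / 2 <= cabs (z - a) by have := ler_cabsB z a; lra.
have zb : cabs z / 2 <= cabs (z - b) by have := ler_cabsB z b; lra.
have cd : c != d.
  apply: contraTneq hcd => ->; rewrite subrr cabs0 -ltNge mulr_gt0 //.
have hM : 0 < h / M by rewrite divr_gt0.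
have I1 := inv_cabs_mul_le z cd.
have kc := inv_sqr_mul_le c hM (ltW zl).
have kd := inv_sqr_mul_le d hM (ltW zl).
rewrite (nut_product _ E) /outer_kernel.
have I2 : (cabs (c - d))^-1 <= (B * h)^-1.
  by rewrite lef_pV2 ?posrE ?mulr_gt0 // (lt_le_trans _ hcd) // mulr_gt0.
have Q0 : 0 <= (cabs (z - c))^-1 + (cabs (z - d))^-1 by rewrite addr_ge0 ?invr_ge0 ?cabs_ge0.
have I3 : (cabs (z - c) * cabs (z - d))^-1 <=
    (B * h)^-1 * ((cabs (z - c))^-1 + (cabs (z - d))^-1).
  by apply: le_trans I1 _; rewrite ler_wpM2r.
have I4 : (cabs (z - a) * cabs (z - b))^-1 <= (cabs z / 2 * (cabs z / 2))^-1.
  have z2 : 0 < cabs z / 2 by rewrite divr_gt0.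
  rewrite lef_pV2 ?posrE ?mulr_gt0 //; last 2 first.
  - exact: lt_le_trans za.
  - exact: lt_le_trans zb.
  by rewrite ler_pM // ltW.
rewrite [leLHS]invfM [X in X * _]invfM.
apply: (@le_trans _ _ ((cabs mu0)^-1 * (cabs z / 2 * (cabs z / 2))^-1 * ((B * h)^-1 *
    ((cabs (z - c))^-1 + (cabs (z - d))^-1)))).
  apply: ler_pM => //; rewrite ?mulr_ge0 ?invr_ge0 ?mulr_ge0 ?cabs_ge0 //.
  by rewrite ler_wpM2l // invr_ge0 cabs_ge0.
apply: (@le_trans _ _ (4 / (cabs mu0 * B * h) * (cabs z ^- 2 * (cabs (z - c))^-1 +
    cabs z ^- 2 * (cabs (z - d))^-1))).
  rewrite le_eqVlt; apply/orP; left; apply/eqP.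
  set u := (cabs (z - c))^-1; set v := (cabs (z - d))^-1.
  by field; rewrite !gt_eqF.
by rewrite ler_wpM2l ?lerD // divr_ge0 // ?mulr_ge0 // ltW.
Qed.

End PointwiseBounds.

(** * Integral bounds closed under sums and multiples *)

Section PlaneIntegralBounds.
Context {R : realType}.
Local Notation C := R[i].
Local Notation mu := (@lebesgue_measure R).
Local Notation RR := (measurableTypeR R * measurableTypeR R)%type.

Definition plane_measurable (g : C -> R) :=
  measurable_fun setT (fun p : RR => g (p.1 +i* p.2)%C).

Definition plane_integral (g : C -> R) : \bar R :=
  (\int[mu \x mu]_p (g (p.1 +i* p.2)%C)%:E)%E.

(** Measurability and nonnegativity are bundled with the bound, so that bounds add and scale without
    side conditions. *)
Definition integral_le (g : C -> R) (v : R) :=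
  [/\ plane_measurable g, forall z, 0 <= g z & (plane_integral g <= v%:E)%E].

Lemma plane_measurable_cabsB (c : C) : plane_measurable (fun z => cabs (z - c)).
Proof.
rewrite /plane_measurable.
under eq_fun do rewrite cabsE.
apply: (@measurableT_comp _ _ _ _ _ _ (@Num.sqrt R)).
  by apply: continuous_measurable_fun; exact: sqrt_continuous.
case: c => x y /=.
by apply: measurable_funD; apply: measurable_funX; apply: measurable_funB.
Qed.

Lemma plane_measurable_cabs : plane_measurable (@cabs R).
Proof.
have := plane_measurable_cabsB 0; rewrite /plane_measurable.
by under eq_fun do rewrite subr0.
Qed.

Lemma plane_integral_leD g g' v v' : integral_le g v -> integral_le g' v' ->
  integral_le (fun z => g z + g' z) (v + v').
Proof.
move=> [mg g0 h] [mg' g0' h']; split.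
- exact: measurable_funD.
- by move=> z; rewrite addr_ge0.
- rewrite /plane_integral; under eq_integral do rewrite EFinD.
  rewrite ge0_integralD //; last 4 first.
  + by move=> p _; rewrite lee_fin.
  + exact/measurable_EFinP.
  + by move=> p _; rewrite lee_fin.
  + exact/measurable_EFinP.
  by rewrite EFinD leeD.
Qed.

Lemma plane_integralZ (k : R) g : 0 <= k -> plane_measurable g -> (forall z, 0 <= g z) ->
  plane_integral (fun z => k * g z) = (k%:E * plane_integral g)%E.
Proof.
move=> k0 mg g0; rewrite /plane_integral; under eq_integral do rewrite EFinM.
rewrite ge0_integralZl_EFin //.
- by move=> p _; rewrite lee_fin.
- exact/measurable_EFinP.
Qed.

Lemma plane_integral_leZ (k : R) g v : 0 <= k -> integral_le g v ->
  integral_le (fun z => k * g z) (k * v).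
Proof.
move=> k0 [mg g0 h]; split.
- by apply: measurable_funM.
- by move=> z; rewrite mulr_ge0.
- by rewrite plane_integralZ // EFinM lee_wpmul2l // lee_fin.
Qed.

Lemma integral_le_kernel1 (c : C) (r : R) : 0 <= r ->
  integral_le (fun z => kernel1 r (cabs (z - c))) (2 * pi * r).
Proof.
move=> r0; split; last exact: integral_kernel1.
- apply: (measurableT_comp (measurable_kernel1 r)); exact: plane_measurable_cabsB.
- by move=> z; rewrite kernel1_ge0 ?cabs_ge0.
Qed.

Lemma integral_le_kernel3 (c : C) (r : R) : 0 < r ->
  integral_le (fun z => kernel3 r (cabs (z - c))) (2 * pi / r).
Proof.
move=> r0; split; last by rewrite /plane_integral integral_kernel3.
- apply: (measurableT_comp (measurable_kernel3 r)); exact: plane_measurable_cabsB.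
- by move=> z; rewrite kernel3_ge0 ?cabs_ge0.
Qed.

(** The inequality serves the upper bound of the metric, the exact value the lower one. *)
Lemma integral_le_kernel2 (a b : R) : 0 < a -> a < b ->
  integral_le (fun z => kernel2 a b (cabs z)) (2 * pi * (ln b - ln a))
  /\ plane_integral (fun z => kernel2 a b (cabs z)) = (2 * pi * (ln b - ln a))%:E.
Proof.
move=> a0 ab.
have E : plane_integral (fun z => kernel2 a b (cabs z)) = (2 * pi * (ln b - ln a))%:E.
  rewrite -(integral_kernel2 0 a0 ab) /plane_integral.
  by under [RHS]eq_integral do rewrite subr0.
split=> //; split; last by rewrite E.
- apply: (measurableT_comp (measurable_kernel2 a b)); exact: plane_measurable_cabs.
- by move=> z; rewrite kernel2_ge0 ?cabs_ge0.
Qed.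

Lemma integral_le_ext f g v : f =1 g -> integral_le f v -> integral_le g v.
Proof. by move=> /funext ->. Qed.

End PlaneIntegralBounds.

(** * Upper and lower bounds for the metric *)

Section SemiflatMetric.
Context {R : realType}.
Local Notation C := R[i].
Local Notation mu := (@lebesgue_measure R).
Variables (mu0 mu1 mu3 : C).
Hypothesis mu00 : mu0 != 0.
Local Notation K := (nut_const mu0 mu1 mu3).
Local Notation M := (4 * K).

Let K1 : 1 <= K. Proof. exact: nut_const_ge1. Qed.
Let M0 : 0 < M. Proof. by have := K1; lra. Qed.
Let m0 : 0 < cabs mu0. Proof. by rewrite cabs_gt0. Qed.

(** Both kernels integrate to multiples of h, against a prefactor of order h^-3. For the inner and
    outer kernels it is 1 / h against 1 / h, so each total is of order h^-2 = 1 / |t|. *)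
Lemma integral_error_kernel (h : R) : 0 < h ->
  integral_le (error_kernel mu0 mu1 mu3 h) (12 * pi * K / M ^+ 2 / h ^+ 2).
Proof.
move=> h0.
have k1 : 1 <= K := K1.
have Mh : 0 < M / h by rewrite divr_gt0.
have hM : 0 <= 2 * (h / M) by rewrite mulr_ge0 // divr_ge0 // ltW.
have k0 : 0 <= 2 * K / (M * h ^+ 3).
  by rewrite divr_ge0 // ?mulr_ge0 ?exprn_ge0 ?(ltW h0) ?(ltW M0) //; lra.
have := plane_integral_leZ k0 (plane_integral_leD (integral_le_kernel3 0 Mh)
    (integral_le_kernel1 0 hM)).
rewrite [X in integral_le _ X](_ : _ = 12 * pi * K / M ^+ 2 / h ^+ 2); last first.
  by field; rewrite !gt_eqF //; lra.
by apply: integral_le_ext => z; rewrite /error_kernel subr0.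
Qed.

Lemma integral_inner_kernel (B h : R) (a b : C) : 0 < B -> 0 < h ->
  integral_le (inner_kernel mu0 mu1 mu3 B h a b)
    (256 * pi * (M + 2) / (cabs mu0 * B ^+ 2) / h ^+ 2).
Proof.
move=> B0 h0.
have Mh : 0 <= (M + 2) / h by rewrite divr_ge0 ?(ltW h0) // addr_ge0 // ltW.
have k0 : 0 <= 64 / (cabs mu0 * B ^+ 2 * h).
  by rewrite divr_ge0 // !mulr_ge0 ?exprn_ge0 ?ltW.
have := plane_integral_leZ k0 (plane_integral_leD (integral_le_kernel1 a Mh)
    (integral_le_kernel1 b Mh)).
rewrite [X in integral_le _ X](_ : _ = 256 * pi * (M + 2) / (cabs mu0 * B ^+ 2) / h ^+ 2) //.
by field; rewrite !gt_eqF.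
Qed.

Lemma integral_outer_kernel (B h : R) (c d : C) : 0 < B -> 0 < h ->
  integral_le (outer_kernel mu0 mu1 mu3 B h c d) (48 * pi * M / (cabs mu0 * B) / h ^+ 2).
Proof.
move=> B0 h0; have k1 : 1 <= K := K1.
have hM : 0 < h / M by rewrite divr_gt0.
have k0 : 0 <= 4 / (cabs mu0 * B * h).
  by rewrite divr_ge0 // !mulr_ge0 ?ltW.
have r0 : 0 <= (h / M) ^- 2 by rewrite invr_ge0 exprn_ge0 // ltW.
have part e := plane_integral_leD (plane_integral_leD (integral_le_kernel3 0 hM)
    (integral_le_kernel3 e hM))
   (plane_integral_leZ r0 (integral_le_kernel1 e (ltW hM))).
have := plane_integral_leZ k0 (plane_integral_leD (part c) (part d)).
rewrite [X in integral_le _ X](_ : _ = 48 * pi * M / (cabs mu0 * B) / h ^+ 2); last first.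
  by field; rewrite !gt_eqF //; lra.
by apply: integral_le_ext => z; rewrite /outer_kernel subr0.
Qed.

Let F t td (z : C) : R := 2 * (cabs (td * z ^- 2) ^+ 2 / cabs (nu mu0 mu1 mu3 t z)).

Let g_sKE t td : g_sK mu0 mu1 mu3 t td = plane_integral (F t td).
Proof. by []. Qed.

Let F_ge0 t td z : 0 <= F t td z.
Proof. by rewrite mulr_ge0 // divr_ge0 ?exprn_ge0 ?cabs_ge0. Qed.

(* The factor cabs z / cabs z is 1, except for its value 0 at z = 0. *)
Let FE t td z : F t td z =
  2 * cabs td ^+ 2 * (cabs z / cabs z) * (cabs (nut mu0 mu1 mu3 t).[z])^-1.
Proof.
rewrite /F; have [->|z0] := eqVneq z 0.
  by rewrite expr0n invr0 mulr0 cabs0 expr0n !mul0r !mulr0 mul0r.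
rewrite nutE // (cabsM td) (cabsM (z ^+ 4)) cabsV !cabsX divff ?cabs_eq0 // mulr1.
rewrite (invfM (cabs z ^+ 4)).
set y := (cabs (nu _ _ _ _ _))^-1.
by field; rewrite cabs_eq0.
Qed.

Let g_EucE (td : C) : g_Euc td = cabs td ^+ 2.
Proof. by rewrite cabsE sqr_sqrtr // addr_ge0 // sqr_ge0. Qed.

(** Factoring [nut] turns its modulus into a product of distances to the roots, which are measurable
    functions of z. *)
Let measurable_F t td : plane_measurable (F t td).
Proof.
have [[[a b] [c d]] /= E] := nut_factor mu1 mu3 t mu00.
rewrite /plane_measurable; under eq_fun do rewrite FE (nut_product _ E).
have m1 := @plane_measurable_cabs R; have m2 := @plane_measurable_cabsB R.
apply: measurable_funM.
  apply: measurable_funM => //; apply: measurable_funM => //.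
  exact: measurable_fun_inv.
apply: measurable_fun_inv; apply: measurable_funM; last first.
  by apply: measurable_funM; apply: m2.
by apply: measurable_funM => //; apply: measurable_funM; apply: m2.
Qed.

Lemma metric_asymptotics : exists k : R, \forall t \near cinfty R, forall td : C,
  (`| g_sK mu0 mu1 mu3 t td
         - (4 * pi * ln (cabs t) * (cabs t)^-1 * g_Euc td)%:E |
      <= (k * (cabs t)^-1 * g_Euc td)%:E)%E.
Proof.
have [B B0 HB] := near_separated_roots mu1 mu3 mu00.
pose cE := 12 * pi * K / M ^+ 2.
pose cI := 256 * pi * (M + 2) / (cabs mu0 * B ^+ 2).
pose cO := 48 * pi * M / (cabs mu0 * B).
have p0 := pi_gt0 R; have k1 : 1 <= K := K1.
have cE0 : 0 < cE by rewrite divr_gt0 ?mulr_gt0 ?exprn_gt0 //; lra.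
have M2 : 0 < M + 2 by rewrite addr_gt0.
have K0 : 0 < K by lra.
have cI0 : 0 < cI by rewrite divr_gt0 // mulr_gt0 // ?mulr_gt0 // exprn_gt0.
have cO0 : 0 < cO by rewrite divr_gt0 // !mulr_gt0.
(* The annulus contributes ln (h / M) - ln (M / h) = ln |t| - 2 ln M, whence 8 pi ln M; the rest
   bounds the error, inner and outer integrals, with the factor 2 of [F]. *)
exists (8 * pi * ln M + 2 * (cE + cI + cO)).
near=> t => td.
have r0 : 0 < cabs t by near: t; exact: near_cinfty_gt.
have [a [b [c [d sep]]]] : exists a b c d : C,
    separated_roots mu0 mu1 mu3 B (Num.sqrt (cabs t)) t a b c d by near: t; exact: HB.
set h := Num.sqrt (cabs t) in sep.
have h0 : 0 < h by rewrite sqrtr_gt0.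
have rh : cabs t = h ^+ 2 by rewrite sqr_sqrtr // ltW.
(* The first two conditions are those of the inner and outer bounds; the third makes the annulus
   nonempty. *)
have b1 : 8 * M / B <= h ^+ 2 by rewrite -rh ltW //; near: t; exact: near_cinfty_gt.
have b2 : 4 * M <= h ^+ 2 by rewrite -rh ltW //; near: t; exact: near_cinfty_gt.
have b3 : M ^+ 2 < h ^+ 2 by rewrite -rh; near: t; exact: near_cinfty_gt.
have Mh : M < h by rewrite -ltr_sqr ?nnegrE ?ltW.
have al0 : 0 < M / h by rewrite divr_gt0.
have alb : M / h < h / M.
  rewrite ltr_pdivrMr // mulrAC ltr_pdivlMr // -!expr2 //.
have lnE : ln (h / M) - ln (M / h) = ln (cabs t) - 2 * ln M.
  rewrite !ln_div ?posrE // rh lnXn // -mulr_natl; ring.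
have G0 : 0 <= cabs td ^+ 2 by rewrite exprn_ge0 ?cabs_ge0.
have G20 : 0 <= 2 * cabs td ^+ 2 by rewrite mulr_ge0.
have [k2 k2E] := integral_le_kernel2 al0 alb.
have hi0 : 0 <= h ^- 2 by rewrite invr_ge0 exprn_ge0 // ltW.
have kE := integral_error_kernel h0.
have kI := integral_inner_kernel a b B0 h0.
have kO := integral_outer_kernel c d B0 h0.
(* In each zone one kernel, or two on the annulus, dominates the integrand, and the others are
   nonnegative. *)
have upper : (plane_integral (F t td) <=
    (2 * cabs td ^+ 2 * (h ^- 2 * (2 * pi * (ln (h / M) - ln (M / h)))
      + cE / h ^+ 2 + cI / h ^+ 2 + cO / h ^+ 2))%:E)%E.
  have kU := plane_integral_leD (plane_integral_leD
    (plane_integral_leD (plane_integral_leZ hi0 k2) kE) kI) kO.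
  have [mU U0 iU] := plane_integral_leZ G20 kU.
  apply: le_trans iU; apply: ge0_le_integral => //.
  - by move=> p _; rewrite lee_fin F_ge0.
  - apply/measurable_EFinP; exact: measurable_F.
  - exact/measurable_EFinP.
  move=> p _; rewrite lee_fin; move: (p.1 +i* p.2)%C => z {p}.
  rewrite FE -mulrA ler_wpM2l //.
  apply: (@le_trans _ _ (cabs (nut mu0 mu1 mu3 t).[z])^-1).
    rewrite ler_piMl ?invr_ge0 ?cabs_ge0 //.
    by have [->|z0] := eqVneq (cabs z) 0; rewrite ?mul0r // divff.
  have [_ e0 _] := kE; have [_ i0 _] := kI; have [_ o0 _] := kO; have [_ k0 _] := k2.
  have e0z := e0 z; have i0z := i0 z; have o0z := o0 z.
  have k0z : 0 <= h ^- 2 * kernel2 (M / h) (h / M) (cabs z) by rewrite mulr_ge0.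
  have [zl|zl] := ltP (cabs z) (M / h).
    have := inner_bound mu00 B0 h0 b1 sep zl; lra.
  have [zr|zr] := leP (cabs z) (h / M); last first.
    have := outer_bound mu00 B0 h0 b2 sep zr; lra.
  have zz : M / h <= cabs z <= h / M by rewrite zl zr.
  have := @annulus_bound R mu0 mu1 mu3 t z h h0 rh zz.
  rewrite ler_norml => /andP[_]; rewrite /kernel2 zz; lra.
(* The error stays on the larger side, which avoids subtracting extended reals; off the annulus the
   smaller integrand is 0. *)
have lower : ((2 * cabs td ^+ 2 * (h ^- 2 * (2 * pi * (ln (h / M) - ln (M / h)))))%:E <=
    plane_integral (F t td) + (2 * cabs td ^+ 2 * (cE / h ^+ 2))%:E)%E.
  have [mk k0 ik] := plane_integral_leZ G20 (plane_integral_leZ hi0 k2).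
  have [mU U0 iU] := plane_integral_leZ G20 kE.
  apply: (@le_trans _ _ (plane_integral (F t td) +
    plane_integral (fun z => (2 * cabs td ^+ 2 * error_kernel mu0 mu1 mu3 h z)%R)))%E;
    last by rewrite leeD2l.
  have -> : (2 * cabs td ^+ 2 * (h ^- 2 * (2 * pi * (ln (h / M) - ln (M / h)))))%:E =
     plane_integral (fun z => 2 * cabs td ^+ 2 * (h ^- 2 * kernel2 (M / h) (h / M) (cabs z))).
    have [mk2 k20 _] := k2.
    have [mk2' k20' _] := plane_integral_leZ hi0 k2.
    by rewrite (plane_integralZ G20 mk2' k20') (plane_integralZ hi0 mk2 k20) k2E -!EFinM.
  rewrite -ge0_integralD //; last 4 first.
  - by move=> p _; rewrite lee_fin F_ge0.
  - apply/measurable_EFinP; exact: measurable_F.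
  - by move=> p _; rewrite lee_fin.
  - exact/measurable_EFinP.
  apply: ge0_le_integral => //.
  - by move=> p _; rewrite lee_fin.
  - exact/measurable_EFinP.
  - apply: emeasurable_funD; apply/measurable_EFinP => //; exact: measurable_F.
  move=> p _; rewrite -EFinD lee_fin; move: (p.1 +i* p.2)%C => z {p}.
  rewrite {1}/kernel2; case: ifPn => zz; last by rewrite !mulr0 addr_ge0 // F_ge0.
  have z0 : 0 < cabs z by apply: lt_le_trans (andP zz).1.
  rewrite FE divff ?gt_eqF // mulr1 -mulrDr ler_wpM2l //.
  have := @annulus_bound R mu0 mu1 mu3 t z h h0 rh zz.
  rewrite ler_norml => /andP[]; lra.
rewrite g_sKE g_EucE.
have I0 : (0%:E <= plane_integral (F t td))%E
    by apply: integral_ge0 => p _; rewrite lee_fin F_ge0.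
(* [upper] excludes the value +oo and nonnegativity excludes -oo, so the integral is finite. *)
move: (plane_integral (F t td)) upper lower I0 => [x| |] //.
rewrite -EFinD !lee_fin => upper lower _.
rewrite lnE in upper lower; rewrite rh.
rewrite rh in upper lower.
have lM : 0 <= ln M by apply: ln_ge0; lra.
set G := cabs td ^+ 2 in G0 G20 upper lower *.
set l := ln (h ^+ 2) in upper lower *; set lm := ln M in lM upper lower *.
set H := (h ^+ 2)^-1 in upper lower *.
(* Once the signs of these products are known, the remaining comparison is linear in them. *)
have GH0 : 0 <= G * H by rewrite mulr_ge0 // invr_ge0 exprn_ge0 // ltW.
have q1 : 0 <= pi * lm * (G * H) by rewrite mulr_ge0 // mulr_ge0 // ltW.
have q2 : 0 <= cE * (G * H) by rewrite mulr_ge0 // ltW.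
have q3 : 0 <= cI * (G * H) by rewrite mulr_ge0 // ltW.
have q4 : 0 <= cO * (G * H) by rewrite mulr_ge0 // ltW.
move: q1 q2 q3 q4 upper lower; move: cE cI cO {cE0 cI0 cO0 kE kI kO} => e1 e2 e3 q1 q2 q3 q4.
rewrite ler_norml => upper lower; apply/andP; split; lra.
Unshelve. all: end_near. Qed.

End SemiflatMetric.

(** The logarithm in the expansion of tau is some [L] with [cexp L = 4 * s^-1 * t], chosen for each
    t, which reflects the choice of branch in tau. *)
Theorem mainTheorem4 (R : realType) (mu0 mu1 mu3 : R[i]) (hmu0 : mu0 != 0)
    (s : R[i]) (hs : s ^+ 2 = - mu0)
    (sq : R[i] -> R[i]) (hsq : forall t, sq t ^+ 2 = t) :
  (exists K : R, \forall t \near cinfty R, forall td : R[i],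
     (`| g_sK mu0 mu1 mu3 t td
         - (4 * pi * ln (cabs t) * (cabs t)^-1 * g_Euc td)%:E |
      <= (K * (cabs t)^-1 * g_Euc td)%:E)%E)
  /\
  (forall z1 z2 z3 z4 tau : R[i] -> R[i],
     labelled_roots mu0 mu1 mu3 s sq z1 z2 z3 z4 ->
     fibre_modulus mu0 mu1 mu3 s z1 z2 z3 z4 tau ->
     exists K : R, \forall t \near cinfty R, exists L : R[i],
       cexp L = 4 * s^-1 * t /\
       cabs (tau t
             - ('i%C / pi%:C * L
                + 'i%C / pi%:C
                  * ((mu1 ^+ 2 - mu0 * mu3 ^+ 2) / (8 * mu0)) * t^-1))
         <= K * cabs t ^- 2).
Proof.
split; first exact: metric_asymptotics.
move=> z1 z2 z3 z4 tau lab hmod.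
exact: (fibre_modulus_asymptotics hmu0 hs hsq lab hmod).
Qed.
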